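(* Let $G$ be a locally compact abelian group, $\gamma\in\Gamma$, $s\ge0$, and assume that the function $\xi\mapsto (1+\gamma(\xi)^2)^{-s}$ belongs to $L^1(G^\wedge,\mu_{G^\wedge})$. Then $H^s_\gamma(G)\hookrightarrow C(G)$: there is a constant $C(\gamma,s)$ such that every $f\in H^s_\gamma(G)$ coincides $\mu_G$-almost everywhere with a continuous function on $G$, and this continuous function satisfies \[ \sup_{x\in G}|f(x)|\le C(\gamma,s)\,\|f\|_{H^s_\gamma(G)}. \]
   Context: $C(G)$ denotes the continuous complex-valued functions on $G$, with $\|f\|_{C(G)}=\sup_{x\in G}|f(x)|$. $G$ is a locally compact abelian group with Haar measure $\mu_G$; $G^\wedge$ is its dual group (continuous homomorphisms $G\to\{z\in\mathbb C:|z|=1\}$, a locally compact abelian group under pointwise multiplication) with Haar measure $\mu_{G^\wedge}$ normalized so that the Plancherel theorem and Fourier inversion hold. For $f\in L^1_{\mu_G}(G)$, $\hat f(\xi)=\int_G\overline{\xi(x)}f(x)\,d\mu_G(x)$, extended to $L^2$ by Plancherel. $\Gamma$ is the set of functions $\gamma:G^\wedge\to[0,\infty)$ for which there is a constant $c_\gamma$ with $\gamma(\alpha\beta)\le c_\gamma[\gamma(\alpha)+\gamma(\beta)]$ for all $\alpha,\beta\in G^\wedge$. For $\gamma\in\Gamma$ and real $s\ge0$, $H^s_\gamma(G)$ is the set of $f\in L^2_{\mu_G}(G)$ with $\|f\|_{H^s_\gamma(G)}=\left(\int_{G^\wedge}(1+\gamma(\xi)^2)^s|\hat f(\xi)|^2\,d\mu_{G^\wedge}(\xi)\right)^{1/2}<\infty$.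 *)

(* Defs.v *)
From HB Require Import structures.
From mathcomp Require Import all_boot all_order all_algebra.
From mathcomp Require Import all_classical all_reals all_analysis.
From mathcomp Require Import complex.
Import Order.TTheory GRing.Theory Num.Theory.
Import numFieldTopology.Exports.
Local Open Scope classical_set_scope.
Local Open Scope ring_scope.

Set Implicit Arguments.
Unset Strict Implicit.
Unset Printing Implicit Defensive.

(* The Borel measurable space of a pointed topological space (a measurable
   structure in mathcomp-analysis requires a pointed carrier). *)
Notation borel_of T := (g_sigma_algebraType (@open T)).

Notation cnorm := ComplexField.Normc.normc.

(* Radon measure on a topological space (Folland's definition):
   finite on compact sets, outer regular on Borel sets, inner regular on
   open sets. *)
Definition radon (R : realType) (T : ptopologicalType)
    (mu : set (borel_of T) -> \bar R) :=
  [/\ (forall K : set T, compact K -> (mu K < +oo)%E),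
      (forall A : set (borel_of T), measurable A ->
         mu A = ereal_inf [set mu U | U in [set U : set T | open U /\ A `<=` U]])
    & (forall U : set T, open U ->
         mu U = ereal_sup [set mu K | K in [set K : set T | compact K /\ K `<=` U]])].

Definition zpt (G : topologicalZmodType) : Type := G.
HB.instance Definition _ (G : topologicalZmodType) := Topological.on (zpt G).
HB.instance Definition _ (G : topologicalZmodType) := isPointed.Build (zpt G) (0 : G).

Definition haar_measure (R : realType) (G : topologicalZmodType)
    (mu : {measure set (borel_of (zpt G)) -> \bar R}) :=
  [/\ radon mu,
      mu setT <> 0%E
    & forall (a : G) (A : set (borel_of (zpt G))), measurable A ->
        mu [set (a + x : zpt G) | x in A] = mu A].

Notation Cpx R := ((R[i])^o).

Definition is_character (R : realType) (G : topologicalZmodType) (xi : G -> Cpx R) :=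
  [/\ continuous xi,
      (forall x y : G, xi (x + y) = xi x * xi y)
    & forall x : G, cnorm (xi x : R[i]) = 1].

Definition dual (R : realType) (G : topologicalZmodType) : Type :=
  set_type (@is_character R G : set {compact-open, G -> Cpx R}).
HB.instance Definition _ (R : realType) (G : topologicalZmodType) :=
  Topological.on (dual R G).

Lemma trivial_character (R : realType) (G : topologicalZmodType) :
  @is_character R G (fun _ => 1).
Proof.
split.
- by move=> x; exact: cvg_cst.
- by move=> x y; rewrite mulr1.
- by move=> x; exact: ComplexField.Normc.normc1.
Qed.

Definition dual_one (R : realType) (G : topologicalZmodType) : dual R G :=
  exist _ ((fun _ => 1) : {compact-open, G -> Cpx R})
    (mem_set (trivial_character R G)).
HB.instance Definition _ (R : realType) (G : topologicalZmodType) :=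
  isPointed.Build (dual R G) (dual_one R G).

Definition char_of (R : realType) (G : topologicalZmodType) (xi : dual R G) : G -> R[i] :=
  set_val xi.

Definition dual_haar_measure (R : realType) (G : topologicalZmodType)
    (nu : {measure set (borel_of (dual R G)) -> \bar R}) :=
  [/\ radon nu,
      nu setT <> 0%E
    & forall (chi : dual R G) (A : set (borel_of (dual R G))), measurable A ->
        nu [set eta | exists2 xi, A xi &
               forall x, char_of eta x = char_of chi x * char_of xi x] = nu A].

Definition cmeasurable d (T : measurableType d) (R : realType) (f : T -> R[i]) :=
  measurable_fun setT (fun x => complex.Re (f x)) /\ measurable_fun setT (fun x => complex.Im (f x)).

Definition cintegral d (T : measurableType d) (R : realType)
    (mu : {measure set T -> \bar R}) (f : T -> R[i]) : R[i] :=
  Complex (fine (\int[mu]_x (complex.Re (f x))%:E)) (fine (\int[mu]_x (complex.Im (f x))%:E)).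

Definition cpow_integral d (T : measurableType d) (R : realType)
    (mu : {measure set T -> \bar R}) (p : nat) (f : T -> R[i]) : \bar R :=
  (\int[mu]_x ((cnorm (f x)) ^+ p)%:E)%E.

Definition L1c d (T : measurableType d) (R : realType)
    (mu : {measure set T -> \bar R}) (f : T -> R[i]) :=
  cmeasurable f /\ (cpow_integral mu 1 f < +oo)%E.

Definition L2c d (T : measurableType d) (R : realType)
    (mu : {measure set T -> \bar R}) (f : T -> R[i]) :=
  cmeasurable f /\ (cpow_integral mu 2 f < +oo)%E.

Definition fourier (R : realType) (G : topologicalZmodType)
    (mu : {measure set (borel_of (zpt G)) -> \bar R}) (f : G -> R[i]) : dual R G -> R[i] :=
  fun xi => cintegral mu (fun x : borel_of (zpt G) => conjc (char_of xi x) * f x).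

Definition plancherel_normalized (R : realType) (G : topologicalZmodType)
    (mu : {measure set (borel_of (zpt G)) -> \bar R})
    (nu : {measure set (borel_of (dual R G)) -> \bar R}) :=
  forall f : G -> R[i], L1c mu f -> L2c mu f ->
    cpow_integral mu 2 f = cpow_integral nu 2 (fourier mu f).

Definition is_fourier_L2 (R : realType) (G : topologicalZmodType)
    (mu : {measure set (borel_of (zpt G)) -> \bar R})
    (nu : {measure set (borel_of (dual R G)) -> \bar R})
    (f : G -> R[i]) (F : dual R G -> R[i]) :=
  cmeasurable (F : borel_of (dual R G) -> R[i]) /\
  exists fn : nat -> G -> R[i],
    [/\ forall n, L1c mu (fn n) /\ L2c mu (fn n),
        cpow_integral mu 2 (fun x => fn n x - f x) @[n --> \oo] --> 0%E
      & cpow_integral nu 2 (fun xi => fourier mu (fn n) xi - F xi) @[n --> \oo] --> 0%E].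

Definition in_Gamma (R : realType) (G : topologicalZmodType) (gamma : dual R G -> R) :=
  (forall xi, 0 <= gamma xi) /\
  exists c : R, forall alpha beta eta : dual R G,
    (forall x, char_of eta x = char_of alpha x * char_of beta x) ->
    gamma eta <= c * (gamma alpha + gamma beta).

(* ||f||_{H^s_gamma}^2 = \int (1+gamma^2)^s |F|^2 dnu, with F the Fourier transform *)
Definition sobolev_norm2 (R : realType) (G : topologicalZmodType)
    (nu : {measure set (borel_of (dual R G)) -> \bar R})
    (gamma : dual R G -> R) (s : R) (F : dual R G -> R[i]) : \bar R :=
  (\int[nu]_xi (((1 + gamma xi ^+ 2) `^ s) * (cnorm (F xi)) ^+ 2)%:E)%E.

(* Main.v *)
Require Import Defs.
From HB Require Import structures.
From mathcomp Require Import all_boot all_order all_algebra.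
From mathcomp Require Import all_classical all_reals all_analysis.
From mathcomp Require Import complex.
From mathcomp Require Import ring lra measurable_realfun.
Import Order.TTheory GRing.Theory Num.Theory.
Import numFieldTopology.Exports.
Local Open Scope classical_set_scope.
Local Open Scope ring_scope.

(** By Cauchy-Schwarz [F] lies in [L1], so [g x], the integral of [F xi * xi x],
    converges absolutely. It is continuous because the evaluation [(xi, x) |-> xi x]
    is jointly continuous and [F] is concentrated on a compact set up to a
    small error. Testing Parseval's identity (obtained by polarization)
    against [h], the restriction of [f - g] to a set [E] of finite measure, and
    exchanging integrals, the integral of [|f - g|^2] over [E] vanishes. Finally
    [f] and [g] vanish outside countably many such sets [E].

    The Haar measures need not be sigma-finite and [xi x] need not be measurable
    for the product sigma-algebra, so Fubini's theorem does not apply. The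
    exchange of integrals is instead proved by cutting a compact set into finitely
    many pieces on which the kernel hardly depends on [x]. *)

Set Implicit Arguments.
Unset Strict Implicit.
Unset Printing Implicit Defensive.

(** * Radon measures *)

Section radon_regularity.
Context (R : realType) (X : ptopologicalType).
Variable m : {measure set (borel_of X) -> \bar R}.
Hypotheses (hX : hausdorff_space X) (rm : radon m).

Lemma borel_open (U : set X) : open U -> measurable (U : set (borel_of X)).
Proof. by move=> oU; exact: sub_sigma_algebra. Qed.

Lemma borel_compact (K : set X) : compact K -> measurable (K : set (borel_of X)).
Proof.
move=> cK; rewrite -(setCK K); apply: measurableC; apply: borel_open.
by apply: closed_openC; exact: compact_closed.
Qed.

(** Since [m E] is finite, outer regularity can be turned by subtraction into a bound on the part of
    [U] outside [E]. *)
Lemma radon_outer (E : set (borel_of X)) (e : R) :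
  measurable E -> (m E < +oo)%E -> 0 < e ->
  exists U : set X, [/\ open U, E `<=` U & (m (U `\` E) < e%:E)%E].
Proof.
move=> mE Efin e0; have [_ out _] := rm.
have Ef : m E \is a fin_num by rewrite ge0_fin_numE.
have := Ef; rewrite {1}(out _ mE) => /(lb_ereal_inf_adherent e0)[_ [U [oU EU] <-]].
rewrite -(out _ mE) => UE; exists U; split => //.
rewrite measureD//; [|exact: borel_open|].
  by rewrite setIidr// lteBlDl.
by rewrite (lt_trans UE)// -(fineK Ef) -EFinD ltry.
Qed.

Lemma radon_inner_open (U : set X) (e : R) :
  open U -> (m U < +oo)%E -> 0 < e ->
  exists K : set X, [/\ compact K, K `<=` U & (m (U `\` K) < e%:E)%E].
Proof.
move=> oU Ufin e0; have [_ _ inn] := rm.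
have Uf : m U \is a fin_num by rewrite ge0_fin_numE.
have := Uf; rewrite {1}(inn _ oU) => /(ub_ereal_sup_adherent e0)[_ [K [cK KU] <-]].
rewrite -(inn _ oU) => UK; exists K; split => //.
have mK := borel_compact cK.
rewrite measureD//; [|exact: borel_open].
rewrite setIidr// lteBlDl//; last first.
  by rewrite ge0_fin_numE// (le_lt_trans _ Ufin)// le_measure ?inE//; exact: borel_open.
by rewrite -lteBlDr//.
Qed.

(** Inner regularity passes from open sets to Borel sets of finite measure: enclose [E] in an open
    [U], fill [U] up to a small error by a compact [F], and remove from [F] a small open set [V]
    containing the part of [U] outside [E]. *)
Lemma radon_inner (E : set (borel_of X)) (e : R) :
  measurable E -> (m E < +oo)%E -> 0 < e ->
  exists K : set X, [/\ compact K, K `<=` E & (m (E `\` K) < e%:E)%E].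
Proof.
move=> mE Efin e0; have d0 : 0 < e / 4 by rewrite divr_gt0.
have [U [oU EU mUE]] := radon_outer mE Efin d0.
have mU := borel_open oU.
have mUDE : measurable (U `\` E : set (borel_of X)) by exact: measurableD.
have Ufin : (m U < +oo)%E.
  rewrite (@measureDI _ _ _ m U E)// setIidr// lte_add_pinfty//.
  by rewrite (lt_trans mUE)// ltry.
have [F [cF FU mUF]] := radon_inner_open oU Ufin d0.
have [V [oV UEV mV]] := radon_outer mUDE (lt_trans mUE (ltry _)) d0.
have mVV := borel_open oV; have mF := borel_compact cF.
exists (F `\` V); split.
- apply: (@subclosed_compact _ _ F) => //.
  by rewrite setDE; apply: closedI; [exact: compact_closed|exact: open_closedC].
- by move=> x [Fx nVx]; apply: contrapT => nEx; apply/nVx/UEV; split => //; exact: FU.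
(* A point of [E] is lost either because it is outside [F] or because it is in [V], and [V] has
   small measure as it barely exceeds [U] minus [E]. *)
- have sub : E `\` (F `\` V) `<=` (U `\` F) `|` ((U `\` E) `|` (V `\` (U `\` E))).
    move=> x [Ex nFV]; have [Fx|nFx] := pselect (F x); last by left; split=> //; exact: EU.
    have Vx : V x by apply: contrapT => nVx; exact: nFV.
    by right; right; split => // -[].
  apply: (@le_lt_trans _ _ (m (U `\` F) + (m (U `\` E) + m (V `\` (U `\` E))))%E).
    apply: (le_trans (le_measure m _ _ sub)); rewrite ?inE.
    - by apply: measurableD => //; exact: measurableD.
    - by apply: measurableU; [exact: measurableD|apply: measurableU; exact: measurableD].
    - apply: (le_trans (measureU2 _ _ _)).
      + exact: measurableD.
      + by apply: measurableU => //; exact: measurableD.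
      + by rewrite leeD2l//; apply: measureU2 => //; exact: measurableD.
  (* Three quarters of [e] bound the three pieces; the last quarter is slack. *)
  have -> : e%:E = ((e/4 + (e/4 + e/4) + e/4)%:E)%E by congr EFin; lra.
  rewrite EFinD -[X in (X < _)%E]adde0 lte_leD//; last by rewrite lee_fin ltW.
  by rewrite !EFinD lteD// lteD.
Qed.

End radon_regularity.

(** * Real-valued integrable functions *)

Local Notation integrable_fct m f := (m.-integrable setT (EFin \o (f : _ -> _))).

Section real_integrable.
Context d (T : measurableType d) (R : realType) (m : {measure set T -> \bar R}).
Implicit Types f g h k : T -> R.

Lemma integrable_fct_meas f : integrable_fct m f -> measurable_fun setT f.
Proof. by move=> /measurable_int /measurable_EFinP. Qed.

Lemma integrable_fct_le f g : measurable_fun setT f -> (forall x, `|f x| <= g x) ->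
  integrable_fct m g -> integrable_fct m f.
Proof.
move=> mf fg; apply: le_integrable => //; first exact/measurable_EFinP.
by move=> x _ /=; rewrite lee_fin (le_trans (fg x))// ler_norm.
Qed.

Lemma integrable_fctD f g : integrable_fct m f -> integrable_fct m g ->
  integrable_fct m (fun x => f x + g x).
Proof. by move=> /integrableD /[apply]; apply; exact: measurableT. Qed.

Lemma integrable_fctB f g : integrable_fct m f -> integrable_fct m g ->
  integrable_fct m (fun x => f x - g x).
Proof. by move=> /integrableB /[apply]; apply; exact: measurableT. Qed.

Lemma integrable_fctZ c f : integrable_fct m f -> integrable_fct m (fun x => c * f x).
Proof. by move=> /integrableZl; apply; exact: measurableT. Qed.

Lemma integrable_fctMl c h f : measurable_fun setT h -> (forall x, `|h x| <= c) ->
  integrable_fct m f -> integrable_fct m (fun x => h x * f x).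
Proof.
move=> mh hc fi; apply: (@integrable_fct_le _ (fun x => c * `|f x|)).
- by apply: measurable_funM => //; exact: integrable_fct_meas.
- by move=> x; rewrite normrM ler_wpM2r.
- by apply: integrable_fctZ; exact: integrable_norm.
Qed.

Lemma Rintegral_norm_le f g : integrable_fct m f -> integrable_fct m g ->
  (forall x, `|f x| <= g x) -> `|\int[m]_x f x| <= \int[m]_x g x.
Proof.
move=> fi gi fg; apply: (le_trans (le_normr_Rintegral _ _)) => //.
by apply: le_Rintegral => //; exact: integrable_norm.
Qed.

Lemma Rintegral_norm_ge0 f : 0 <= \int[m]_x `|f x|.
Proof. by apply: Rintegral_ge0. Qed.

Lemma EFin_Rintegral f : integrable_fct m f -> (\int[m]_x f x)%:E = (\int[m]_x (f x)%:E)%E.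
Proof. by move=> fi; rewrite /Rintegral fineK//; exact: integrable_fin_num. Qed.

Lemma indic_norm_le1 (A : set T) x : `|\1_A x : R| <= 1.
Proof. by rewrite indicE; case: (_ \in _); rewrite ?normr0 ?normr1. Qed.

Lemma integrable_fct_indic (A : set T) : measurable A -> (m A < +oo)%E ->
  integrable_fct m (\1_A : T -> R).
Proof.
move=> mA Afin; apply/integrableP; split; first exact/measurable_EFinP.
under eq_integral do rewrite /= ger0_norm//.
by rewrite integral_indic// setIT.
Qed.

Lemma integrable_fct_indicM (A : set T) k : measurable A -> integrable_fct m k ->
  integrable_fct m (fun x => \1_A x * k x).
Proof.
by move=> mA; apply: (@integrable_fctMl 1) => //; exact: indic_norm_le1.
Qed.

End real_integrable.

(** * Concentration of integrable functions on compact sets *)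

Section radon_tail.
Context (R : realType) (X : ptopologicalType).
Variable m : {measure set (borel_of X) -> \bar R}.
Hypotheses (hX : hausdorff_space X) (rm : radon m).

(** This is Markov's inequality. *)
Lemma integrable_level_lty (k : borel_of X -> R) (a : R) : 0 < a -> integrable_fct m k ->
  (m [set x | (a <= `|k x|)%R] < +oo)%E.
Proof.
move=> a0 ki; have [mk koo] := integrableP _ _ _ ki.
have := @le_integral_abse _ _ _ m setT measurableT _ a mk a0.
rewrite setTI => /le_lt_trans/(_ koo).
under eq_set do rewrite /= lee_fin.
have [|] := ltP (m [set x | (a <= `|k x|)%R]) +oo%E => //.
by rewrite leye_eq => /eqP -> ; rewrite mulry gtr0_sg// mul1e.
Qed.

(** By dominated convergence [k] is almost carried by a level set [A n] on which [|k|] lies between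
    [1/(n+1)] and [n+1]. The lower bound gives [A n] finite measure, so that inner regularity
    applies; the upper bound controls the loss from [A n] to a compact subset. *)
Lemma radon_tail (k : borel_of X -> R) (e : R) : integrable_fct m k -> 0 < e ->
  exists2 K : set X, compact K & \int[m]_x `|k x - \1_K x * k x| < e.
Proof.
move=> ki e0; have mk := integrable_fct_meas ki.
have mnk : measurable_fun setT (fun x => `|k x|) by exact: measurableT_comp.
pose A n := [set x | n.+1%:R^-1 <= `|k x| <= n.+1%:R].
have mA n : measurable (A n : set (borel_of X)).
  rewrite (_ : A n = (fun x => `|k x|) @^-1` `[n.+1%:R^-1, n.+1%:R]%classic).
    by rewrite -[X in measurable X]setTI; exact: mnk.
  by apply/seteqP; split => x /=; rewrite in_itv.
pose f_ n x := (\1_(~` A n) x * `|k x|)%:E.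
have mf_ n : measurable_fun setT (f_ n).
  apply/measurable_EFinP; apply: measurable_funM => //.
  by apply: measurable_indic; exact: measurableC.
have f_0 x : f_ ^~ x @ \oo --> (0 : \bar R).
  apply: cvg_near_cst; have [k0|k0] := eqVneq (k x) 0.
    by apply: nearW => n; rewrite /f_ k0 normr0 mulr0.
  near=> n; rewrite /f_ indicE memNset ?mul0r//=; apply; rewrite /A /=.
  have big (a : R) : a <= n%:R -> a <= n.+1%:R by move/le_trans; apply; rewrite ler_nat.
  apply/andP; split; last by apply: big; near: n; exact: nbhs_infty_ger.
  rewrite -[leRHS]invrK lef_pV2 ?posrE ?invr_gt0 ?normr_gt0//.
  by apply: big; near: n; exact: nbhs_infty_ger.
have nki := integrable_norm ki.
have : (\int[m]_x f_ n x)%E @[n --> \oo] --> (\int[m]_x (cst 0%E) x)%E.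
  apply: (dominated_cvg _ mf_ _ _ nki) => //.
  move=> n x _; rewrite /f_ /= lee_fin normrM normr_id ler_piMl//.
  exact: indic_norm_le1.
rewrite integral0 => /fine_cvgP[_ /cvgrPdist_lt/(_ (e/2))].
rewrite divr_gt0// => /(_ isT)[n _ /(_ n)]; rewrite /= leqnn => /(_ isT) hn.
have Afin : (m (A n) < +oo)%E.
  apply: le_lt_trans (@integrable_level_lty k n.+1%:R^-1 _ ki) => //.
  apply: le_measure; rewrite ?inE//.
    rewrite (_ : [set _ | _] = (fun x => `|k x|) @^-1` `[n.+1%:R^-1, +oo[%classic).
      by rewrite -[X in measurable X]setTI; exact: mnk.
    by apply/seteqP; split => x /=; rewrite in_itv /= andbT.
  by move=> x /andP[].
(* On [A n] the function is at most [n+1], so a loss of measure below this threshold costs less than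
   [e / 2] in the integral. *)
have d0 : 0 < e / 2 / n.+1%:R by rewrite !divr_gt0.
have [K [cK KA mAK]] := radon_inner hX rm (mA n) Afin d0.
have mK := borel_compact hX cK.
have mAD : measurable (A n `\` K : set (borel_of X)) by exact: measurableD.
have iind : integrable_fct m (\1_(A n `\` K : set (borel_of X)) : _ -> R).
  by apply: integrable_fct_indic => //; rewrite (lt_trans mAK)// ltry.
exists K => //; apply: (@le_lt_trans _ _ (\int[m]_x (\1_(~` A n) x * `|k x| + n.+1%:R * \1_(A n `\` K) x))).
  have i1 : integrable_fct m (fun x => \1_(~` A n) x * `|k x|).
    apply: (@integrable_fctMl _ _ _ _ 1) => //.
      by apply: measurable_indic; exact: measurableC.
    exact: indic_norm_le1.
  apply: le_Rintegral => //.
  - apply: integrable_norm; apply: integrable_fctB => //.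
    apply: (@integrable_fctMl _ _ _ _ 1) => //.
    exact: indic_norm_le1.
  - by apply: integrable_fctD => //; apply: integrable_fctZ.
  move=> x _; rewrite !indicE !(in_setC,in_setD).
  have [Ax|Ax] := boolP (x \in A n); have [Kx|Kx] := boolP (x \in K) => //=;
    rewrite ?(mul0r, mul1r, mulr0, mulr1, subrr, subr0, normr0, add0r, addr0)//.
  by move: Ax; rewrite inE => /andP[].
rewrite RintegralD//; last 2 first.
- apply: (@integrable_fctMl _ _ _ _ 1) => //.
    by apply: measurable_indic; exact: measurableC.
  exact: indic_norm_le1.
- exact: integrable_fctZ.
rewrite RintegralZl// (splitr e) ltrD//.
  by move: hn; rewrite sub0r normrN; apply: le_lt_trans; exact: ler_norm.
rewrite mulrC -ltr_pdivlMr// /Rintegral integral_indic// setIT.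
rewrite -lte_fin fineK//.
by rewrite ge0_fin_numE// (lt_trans mAK)// ltry.
Unshelve. all: end_near. Qed.

End radon_tail.

(** * Integral transforms with a continuous kernel *)

Lemma continuous_borel_measurable (R : realType) (X : ptopologicalType) (f : X -> R) :
  continuous f -> measurable_fun setT (f : borel_of X -> R).
Proof.
move=> cf; apply: (measurability (@RGenOpens.G R)).
  exact: RGenOpens.measurableE.
move=> _ [_ [a [b ->] <-]]; rewrite setTI; apply: borel_open.
by apply: open_comp; [move=> x _; exact: cf|exact: interval_open].
Qed.

Section kernel_transform.
Context (R : realType) (X : ptopologicalType) (Y : topologicalType).
Variables (m : {measure set (borel_of X) -> \bar R}) (phi : X -> Y -> R).
Hypothesis phi_cont : continuous (fun z : X * Y => phi z.1 z.2).

Lemma kernel_near (x0 : X) (y0 : Y) (e : R) : 0 < e ->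
  \forall x \near x0 & y \near y0, `|phi x y - phi x0 y0| < e.
Proof.
move=> e0; have /cvgrPdist_lt/(_ e e0) := @phi_cont (x0, y0).
by apply: filterS => -[x y] /=; rewrite distrC.
Qed.

Lemma kernel_contl (y : Y) : continuous (phi ^~ y).
Proof.
move=> x0; apply/cvgrPdist_lt => e /(kernel_near x0 y)[[A B] /= [A0 B0] AB].
by apply: filterS A0 => x Ax; rewrite distrC; apply: (AB (x, y)); split => //; exact: nbhs_singleton.
Qed.

(** A tube lemma: compactness, in its near-covering form, makes the local estimates of joint
    continuity uniform in [x] over [K]. *)
Lemma kernel_tube (K : set X) (y0 : Y) (e : R) : compact K -> 0 < e ->
  \forall y \near y0, forall x, K x -> `|phi x y - phi x y0| < e.
Proof.
move=> /compact_near_coveringP cK e0.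
apply: (cK _ (nbhs y0) (fun y x => `|phi x y - phi x y0| < e)) => x Kx.
have e20 : 0 < e / 2 by rewrite divr_gt0.
have [[A B] /= [A0 B0] AB] := kernel_near x y0 e20.
exists (A, B) => //= -[x' y'] /= [Ax' By'].
have h1 := AB (x', y') (conj Ax' By').
have h2 := AB (x', y0) (conj Ax' (nbhs_singleton B0)).
(* Joint continuity at [(x, y0)] compares both values with [phi x y0], hence the halved [e]. *)
have -> : phi x' y' - phi x' y0 = (phi x' y' - phi x y0) - (phi x' y0 - phi x y0) by ring.
by rewrite (splitr e) (le_lt_trans (ler_normB _ _))// ltrD.
Qed.

Hypothesis phi_le1 : forall x y, `|phi x y| <= 1.

Lemma kernel_integrable k y : integrable_fct m k -> integrable_fct m (fun x => phi x y * k x).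
Proof.
apply: (@integrable_fctMl _ _ _ _ 1) => //.
by apply: continuous_borel_measurable; exact: kernel_contl.
Qed.

Hypotheses (hX : hausdorff_space X) (rm : radon m).

(** On a compact set carrying most of [k] the kernel varies uniformly little by [kernel_tube];
    elsewhere its variation is at most 2 and the remaining mass is below [e / 4]. *)
Lemma transform_continuous k : integrable_fct m k ->
  continuous (fun y => \int[m]_x (phi x y * k x)).
Proof.
move=> ki y0; apply/cvgrPdist_lt => e e0.
have nki := integrable_norm ki.
set N := \int[m]_x `|k x|; have N0 : 0 <= N := Rintegral_norm_ge0 _ _.
have [|K cK tK] := @radon_tail _ _ _ hX rm k (e / 4) ki; first by rewrite divr_gt0.
have mK := borel_compact hX cK.
(* Adding 1 to the norm [N] keeps the divisor positive when [N] vanishes. *)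
pose d := e / 2 / (N + 1).
have d0 : 0 < d by rewrite !divr_gt0// ltr_wpDl.
have := kernel_tube y0 cK d0; apply: filterS => y hy.
rewrite -RintegralB//; [|exact: kernel_integrable..].
have ikK : integrable_fct m (fun x => k x - \1_K x * k x).
  by apply: integrable_fctB => //; exact: integrable_fct_indicM.
apply: (@le_lt_trans _ _ (\int[m]_x (d * `|k x| + 2 * `|k x - \1_K x * k x|))).
  apply: Rintegral_norm_le.
  - by apply: integrable_fctB; exact: kernel_integrable.
  - by apply: integrable_fctD; apply: integrable_fctZ => //; exact: integrable_norm.
  move=> x; rewrite -mulrBl normrM indicE; have [xK|xK] := boolP (x \in K).
    rewrite mul1r subrr normr0 mulr0 addr0 ler_wpM2r// distrC ltW// hy//.
    by rewrite inE in xK.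
  rewrite mul0r subr0 -mulrDl ler_wpM2r//.
  rewrite (le_trans (ler_normB _ _))// (le_trans (lerD (phi_le1 _ _) (phi_le1 _ _)))//.
  by rewrite -[leLHS]add0r lerD// ltW.
rewrite RintegralD//; [|by apply: integrable_fctZ => //; exact: integrable_norm..].
rewrite !RintegralZl//; [|exact: integrable_norm].
rewrite (splitr e) ler_ltD//; last by rewrite mulrC -ltr_pdivlMr//; lra.
rewrite -/N /d mulrAC ler_pdivrMr ?ltr_wpDl// ler_wpM2l ?lerDl//.
by rewrite divr_ge0// ltW.
Qed.

Lemma transform_le k y : integrable_fct m k ->
  `|\int[m]_x (phi x y * k x)| <= \int[m]_x `|k x|.
Proof.
move=> ki; apply: Rintegral_norm_le; [exact: kernel_integrable|exact: integrable_norm|].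
by move=> x; rewrite normrM ler_piMl.
Qed.

Lemma transformD k k' y : integrable_fct m k -> integrable_fct m k' ->
  \int[m]_x (phi x y * (k x + k' x)) =
  \int[m]_x (phi x y * k x) + \int[m]_x (phi x y * k' x).
Proof.
move=> ki ki'; rewrite -RintegralD//; [|exact: kernel_integrable..].
by apply: eq_Rintegral => x _; rewrite mulrDr.
Qed.

End kernel_transform.

(** * Iterated integrals against a kernel *)

Section kernel_pairing.
Context (R : realType) (X Y : ptopologicalType).
Variables (m : {measure set (borel_of X) -> \bar R}) (n : {measure set (borel_of Y) -> \bar R}).
Variable (phi : X -> Y -> R).
Hypothesis phi_cont : continuous (fun z : X * Y => phi z.1 z.2).
Hypothesis phi_le1 : forall x y, `|phi x y| <= 1.
Hypotheses (hX : hausdorff_space X) (rm : radon m).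

Definition kernel_pairing (k : X -> R) (h : Y -> R) :=
  \int[n]_y (\int[m]_x (phi x y * k x) * h y).

(** The inner integral is continuous and bounded in [y]; its continuity supplies the measurability
    that would otherwise come from Fubini's theorem. *)
Lemma kernel_pairing_integrable k h : integrable_fct m k -> integrable_fct n h ->
  integrable_fct n (fun y => \int[m]_x (phi x y * k x) * h y).
Proof.
move=> ki hi; apply: (@integrable_fctMl _ _ _ _ (\int[m]_x `|k x|)) => //.
  by apply: continuous_borel_measurable; exact: transform_continuous.
by move=> y; exact: transform_le.
Qed.

Lemma kernel_pairing_le k h : integrable_fct m k -> integrable_fct n h ->
  `|kernel_pairing k h| <= (\int[m]_x `|k x|) * \int[n]_y `|h y|.
Proof.
move=> ki hi; rewrite -RintegralZl//; last exact: integrable_norm.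
apply: Rintegral_norm_le; first exact: kernel_pairing_integrable.
  by apply: integrable_fctZ; exact: integrable_norm.
by move=> y; rewrite normrM ler_wpM2r// transform_le.
Qed.

Lemma kernel_pairingDl k k' h : integrable_fct m k -> integrable_fct m k' ->
  integrable_fct n h ->
  kernel_pairing (fun x => k x + k' x) h = kernel_pairing k h + kernel_pairing k' h.
Proof.
move=> ki ki' hi; rewrite /kernel_pairing -RintegralD//; [|exact: kernel_pairing_integrable..].
by apply: eq_Rintegral => y _; rewrite transformD// mulrDl.
Qed.

Lemma kernel_pairingDr k h h' : integrable_fct m k -> integrable_fct n h ->
  integrable_fct n h' ->
  kernel_pairing k (fun y => h y + h' y) = kernel_pairing k h + kernel_pairing k h'.
Proof.
move=> ki hi hi'; rewrite /kernel_pairing -RintegralD//; [|exact: kernel_pairing_integrable..].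
by apply: eq_Rintegral => y _; rewrite mulrDr.
Qed.

End kernel_pairing.

(** * Exchange of the order of integration *)

Section kernel_swap.
Context (R : realType) (X Y : ptopologicalType).
Variables (m : {measure set (borel_of X) -> \bar R}) (n : {measure set (borel_of Y) -> \bar R}).
Variable (phi : X -> Y -> R).
Hypothesis phi_cont : continuous (fun z : X * Y => phi z.1 z.2).
Hypothesis phi_le1 : forall x y, `|phi x y| <= 1.
Hypotheses (hX : hausdorff_space X) (rm : radon m).
Hypotheses (hY : hausdorff_space Y) (rn : radon n).

(** With the arguments flipped, the lemmas on pairings also apply to the opposite order of
    integration. *)
Let psi y x := phi x y.

Lemma kernel_flip_cont : continuous (fun z : Y * X => psi z.1 z.2).
Proof.
move=> [y x]; apply/cvgrPdist_lt => e /(kernel_near phi_cont x y)[[A B] /= [A0 B0] AB].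
exists (B, A) => // -[y' x'] /= [By' Ax']; rewrite distrC.
exact: (AB (x', y')).
Qed.

Let psi_le1 y x : `|psi y x| <= 1.
Proof. exact: phi_le1. Qed.

(** The defect of the exchange. It is additive in each argument and bounded by the product of the
    [L1] norms, so it may be estimated piece by piece. *)
Let T k h := kernel_pairing m n phi k h - kernel_pairing n m psi h k.

Let T_le k h : integrable_fct m k -> integrable_fct n h ->
  `|T k h| <= 2 * ((\int[m]_x `|k x|) * \int[n]_y `|h y|).
Proof.
move=> ki hi; rewrite (le_trans (ler_normB _ _))// mulr_natl mulr2n lerD//.
  exact: kernel_pairing_le.
rewrite mulrC; apply: kernel_pairing_le => //; exact: kernel_flip_cont.
Qed.

Let TDl k k' h : integrable_fct m k -> integrable_fct m k' -> integrable_fct n h ->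
  T (fun x => k x + k' x) h = T k h + T k' h.
Proof.
move=> ki ki' hi; rewrite /T kernel_pairingDl// kernel_pairingDr//; last exact: kernel_flip_cont.
by rewrite opprD addrACA.
Qed.

Let TDr k h h' : integrable_fct m k -> integrable_fct n h -> integrable_fct n h' ->
  T k (fun y => h y + h' y) = T k h + T k h'.
Proof.
move=> ki hi hi'; rewrite /T kernel_pairingDr// kernel_pairingDl//; last exact: kernel_flip_cont.
by rewrite opprD addrACA.
Qed.

(* Both iterated integrals are compared to the one for the kernel
   [phi x0 y], for which the swap is trivial. *)
Let T_osc k h (x0 : X) (d : R) : integrable_fct m k -> integrable_fct n h ->
  (forall x y, k x != 0 -> h y != 0 -> `|phi x y - phi x0 y| <= d) ->
  `|T k h| <= 2 * d * ((\int[m]_x `|k x|) * \int[n]_y `|h y|).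
Proof.
move=> ki hi osc; have psi_cont := kernel_flip_cont.
have nki := integrable_norm ki; have nhi := integrable_norm hi.
have ix0 := kernel_integrable psi_cont psi_le1 x0 hi.
pose c := (\int[m]_x k x) * \int[n]_y (phi x0 y * h y).
have c1 : `|kernel_pairing m n phi k h - c| <= d * ((\int[m]_x `|k x|) * \int[n]_y `|h y|).
  rewrite /c -RintegralZl// /kernel_pairing -RintegralB//; last 2 first.
    exact: kernel_pairing_integrable.
    exact: integrable_fctZ.
  rewrite mulrA -RintegralZl//.
  apply: Rintegral_norm_le.
  - apply: integrable_fctB; first exact: kernel_pairing_integrable.
    exact: integrable_fctZ.
  - exact: integrable_fctZ.
  move=> y; rewrite mulrA -mulrBl normrM.
  have [->|hy0] := eqVneq (h y) 0; first by rewrite normr0 !mulr0.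
  rewrite ler_wpM2r// [(\int[m]_x k x) * _]mulrC -[phi x0 y * _]RintegralZl// -RintegralB//; last 2 first.
    exact: kernel_integrable.
    exact: integrable_fctZ.
  rewrite -RintegralZl//.
  apply: Rintegral_norm_le.
  - apply: integrable_fctB; first exact: kernel_integrable.
    exact: integrable_fctZ.
  - exact: integrable_fctZ.
  move=> x; rewrite -mulrBl normrM.
  have [->|kx0] := eqVneq (k x) 0; first by rewrite normr0 !mulr0.
  by rewrite ler_wpM2r// osc.
have c2 : `|kernel_pairing n m psi h k - c| <= d * ((\int[m]_x `|k x|) * \int[n]_y `|h y|).
  rewrite /c mulrC -RintegralZl// /kernel_pairing -RintegralB//; last 2 first.
    exact: kernel_pairing_integrable.
    exact: integrable_fctZ.
  rewrite [(\int[m]_x _) * _]mulrC mulrA -RintegralZl//.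
  apply: Rintegral_norm_le.
  - apply: integrable_fctB; first exact: kernel_pairing_integrable.
    exact: integrable_fctZ.
  - exact: integrable_fctZ.
  move=> x; rewrite -mulrBl normrM.
  have [->|kx0] := eqVneq (k x) 0; first by rewrite normr0 !mulr0.
  rewrite ler_wpM2r// -RintegralB//; last first.
    exact: kernel_integrable.
  rewrite -RintegralZl//.
  apply: Rintegral_norm_le.
  - by apply: integrable_fctB => //; exact: kernel_integrable.
  - exact: integrable_fctZ.
  move=> y; rewrite -mulrBl normrM.
  have [->|hy0] := eqVneq (h y) 0; first by rewrite normr0 !mulr0.
  by rewrite ler_wpM2r// osc.
rewrite /T -mulrA mulr_natl mulr2n.
set a := kernel_pairing _ _ _ k h in c1 *; set b := kernel_pairing _ _ _ h k in c2 *.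
have -> : a - b = (a - c) - (b - c) by ring.
by rewrite (le_trans (ler_normB _ _))// lerD.
Qed.

(** Induction on the list of centres: on the part of [A] inside [U x0] the kernel oscillates by at
    most [d] and [T_osc] applies, while the rest is covered by the remaining sets. The pieces are
    disjoint, so their [L1] norms add up and the bound does not grow with the number of sets. *)
Let T_cover (k : X -> R) (h : Y -> R) (L : set Y) (d : R) (U : X -> set X) (s : seq X) (A : set (borel_of X)) :
  integrable_fct m k -> integrable_fct n h ->
  (forall y, h y != 0 -> L y) ->
  (forall x, open (U x)) ->
  (forall x0 x, U x0 x -> forall y, L y -> `|phi x y - phi x0 y| <= d) ->
  measurable A -> (forall x, A x -> exists2 x0, x0 \in s & U x0 x) ->
  `|T (fun x => \1_A x * k x) h| <=
     2 * d * ((\int[m]_x `|\1_A x * k x|) * \int[n]_y `|h y|).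
Proof.
move=> ki hi hL oU Ud; elim: s A => [|x0 s IHs] A mA As.
  (* With no set left in the cover [A] is empty, so any base point will do. *)
  apply: (@T_osc _ _ point) => //; first exact: integrable_fct_indicM.
  by move=> x y; rewrite indicE memNset ?mul0r ?eqxx// => /As[].
have mU : measurable (U x0 : set (borel_of X)) by exact: borel_open.
have mAU : measurable (A `&` U x0 : set (borel_of X)) by exact: measurableI.
have mAD : measurable (A `\` U x0 : set (borel_of X)) by exact: measurableD.
have i1 := integrable_fct_indicM mAU ki.
have i2 := integrable_fct_indicM mAD ki.
have split1 x : \1_A x * k x = \1_(A `&` U x0) x * k x + \1_(A `\` U x0) x * k x.
  rewrite !indicE in_setI in_setD.
  by case: (_ \in _); case: (_ \in _); rewrite /= ?(mul0r,addr0,add0r).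
have -> : (fun x => \1_A x * k x) =
  (fun x => \1_(A `&` U x0) x * k x + \1_(A `\` U x0) x * k x) by apply/funext.
rewrite TDl//.
have -> : \int[m]_x `|\1_A x * k x| =
   \int[m]_x `|\1_(A `&` U x0) x * k x| + \int[m]_x `|\1_(A `\` U x0) x * k x|.
  rewrite -RintegralD//; [|exact: integrable_norm..].
  apply: eq_Rintegral => x _; rewrite !indicE in_setI in_setD.
  by case: (_ \in _); case: (_ \in _); rewrite /= ?(mul0r,normr0,addr0,add0r).
rewrite [(_ + \int[m]_x _) * _]mulrDl mulrDr (le_trans (ler_normD _ _))// lerD//.
  apply: (@T_osc _ _ x0) => // x y; rewrite indicE => kx /hL Ly.
  apply: Ud => //; move: kx; case: (boolP (x \in _)) => [|_].
    by rewrite inE => -[].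
  by rewrite mul0r eqxx.
apply: IHs => // x [Ax nUx]; have [x1] := As x Ax.
by rewrite inE => /predU1P[-> //|x1s Ux1]; exists x1.
Qed.

(** Both functions are truncated to compact sets [K] and [L] at an [L1] cost below [e]. Then [K] is
    covered by finitely many open sets on which the kernel varies by less than [e], uniformly over
    [L], and [T_cover] bounds the defect of the truncated pair. *)
Lemma kernel_swap k h : integrable_fct m k -> integrable_fct n h ->
  \int[n]_y (\int[m]_x (phi x y * k x) * h y) = \int[m]_x (\int[n]_y (phi x y * h y) * k x).
Proof.
move=> ki hi; apply/eqP; rewrite -subr_eq0 -normr_le0 -/(kernel_pairing m n phi k h).
rewrite -/(kernel_pairing n m psi h k) -/(T k h).
set M := \int[m]_x `|k x|; set N := \int[n]_y `|h y|.
have M0 : 0 <= M := Rintegral_norm_ge0 _ _.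
have N0 : 0 <= N := Rintegral_norm_ge0 _ _.
(* The three terms of the factor come from the truncated pair, from the tail of [k] and from the
   tail of [h]. As the factor is independent of [e], the defect is zero. *)
suff main e : 0 < e -> `|T k h| <= e * (2 * (M * N) + 2 * N + 2 * M).
  apply/ler_addgt0Pl => e e0; rewrite addr0.
  set B := 2 * (M * N) + 2 * N + 2 * M in main.
  have B0 : 0 <= B by rewrite !addr_ge0// ?mulr_ge0.
  have B1 : 0 < B + 1 by rewrite ltr_wpDl.
  apply: (le_trans (main (e / (B + 1)) _)); first by rewrite divr_gt0.
  rewrite mulrAC ler_pdivrMr// ler_wpM2l ?lerDl//; exact: ltW.
move=> e0.
have [K cK tK] := radon_tail hX rm ki e0.
have [L cL tL] := radon_tail hY rn hi e0.
have mK := borel_compact hX cK; have mL := borel_compact hY cL.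
pose k1 x := \1_K x * k x; pose h1 y := \1_L y * h y.
have k1i : integrable_fct m k1 by exact: integrable_fct_indicM.
have h1i : integrable_fct n h1 by exact: integrable_fct_indicM.
pose k2 x := k x - k1 x; pose h2 y := h y - h1 y.
have k2i : integrable_fct m k2 by exact: integrable_fctB.
have h2i : integrable_fct n h2 by exact: integrable_fctB.
have k1M : \int[m]_x `|k1 x| <= M.
  apply: le_Rintegral => //; [exact: integrable_norm|exact: integrable_norm|].
  by move=> x _; rewrite normrM ler_piMl// indic_norm_le1.
have h1N : \int[n]_x `|h1 x| <= N.
  apply: le_Rintegral => //; [exact: integrable_norm|exact: integrable_norm|].
  by move=> x _; rewrite normrM ler_piMl// indic_norm_le1.
have -> : T k h = T k1 h1 + T k2 h1 + T k h2.
  rewrite -TDl// (_ : (fun x => k1 x + k2 x) = k); last first.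
    by apply/funext => x; rewrite /k2 addrC subrK.
  rewrite -TDr// (_ : (fun x => h1 x + h2 x) = h)//.
  by apply/funext => x; rewrite /h2 addrC subrK.
rewrite (le_trans (ler_normD _ _))// mulrDr lerD//; last first.
  apply: (le_trans (T_le _ _)) => //; have -> : e * (2 * M) = 2 * (M * e) by ring.
  by rewrite ler_wpM2l// ler_wpM2l// ltW.
rewrite (le_trans (ler_normD _ _))// mulrDr lerD//; last first.
  apply: (le_trans (T_le _ _)) => //; have -> : e * (2 * N) = 2 * (e * N) by ring.
  rewrite ler_wpM2l//.
  by rewrite ler_pM// ?Rintegral_norm_ge0// ltW.
(* By the tube lemma with exchanged roles the set before taking the interior is a neighbourhood of
   [x0], so these interiors cover [K]. *)
pose U x0 := [set x | forall y, L y -> `|phi x y - phi x0 y| < e]°.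
have [s sK Kc] : finite_subset_cover K U K.
  move: cK; rewrite compact_cover; apply => [x Kx|x Kx]; first exact: open_interior.
  exists x => //; apply: filterS (kernel_tube kernel_flip_cont x cL e0) => x' hx' y Ly.
  exact: hx'.
have := @T_cover k h1 L e U (finmap.enum_fset s) K ki h1i.
rewrite -/k1 => H; apply: (le_trans (H _ _ _ _ _)).
- by move=> y; rewrite /h1 indicE; have [|] := boolP (y \in L); rewrite ?inE// mul0r eqxx.
- by move=> x; exact: open_interior.
- by move=> x0 x /interior_subset Ux y Ly; rewrite ltW// Ux.
- exact: mK.
- by move=> x /Kc[x0 x0s Ux]; exists x0.
- have -> : e * (2 * (M * N)) = 2 * e * (M * N) by ring.
  apply: ler_wpM2l; first by rewrite mulr_ge0// ltW.
  by apply: ler_pM => //; exact: Rintegral_norm_ge0.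
Qed.

End kernel_swap.

(** * Complex numbers and characters *)

Section complex_topology.
Context (R : realType).
Implicit Types z : R[i].
Local Open Scope complex_scope.

Lemma ReD z w : complex.Re (z + w) = complex.Re z + complex.Re w.
Proof. by case: z w => [? ?] []. Qed.

Lemma ImD z w : complex.Im (z + w) = complex.Im z + complex.Im w.
Proof. by case: z w => [? ?] []. Qed.

Lemma ReM z w :
  complex.Re (z * w) = complex.Re z * complex.Re w - complex.Im z * complex.Im w.
Proof. by case: z w => [? ?] []. Qed.

Lemma ImM z w :
  complex.Im (z * w) = complex.Re z * complex.Im w + complex.Im z * complex.Re w.
Proof. by case: z w => [? ?] []. Qed.

Lemma ReB z w : complex.Re (z - w) = complex.Re z - complex.Re w.
Proof. by case: z w => [? ?] []. Qed.

Lemma ImB z w : complex.Im (z - w) = complex.Im z - complex.Im w.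
Proof. by case: z w => [? ?] []. Qed.

Lemma normc_sqr z : cnorm z ^+ 2 = complex.Re z ^+ 2 + complex.Im z ^+ 2.
Proof. by case: z => a b /=; rewrite sqr_sqrtr// addr_ge0// sqr_ge0. Qed.

Lemma normc_ge0 z : 0 <= cnorm z.
Proof. by case: z => a b /=; exact: sqrtr_ge0. Qed.

Lemma normr_Re_le z : `|complex.Re z| <= cnorm z.
Proof.
by rewrite -(@ler_pXn2r _ 2)// ?nnegrE ?normc_ge0// real_normK ?num_real// normc_sqr lerDl sqr_ge0.
Qed.

Lemma normr_Im_le z : `|complex.Im z| <= cnorm z.
Proof.
by rewrite -(@ler_pXn2r _ 2)// ?nnegrE ?normc_ge0// real_normK ?num_real// normc_sqr lerDr sqr_ge0.
Qed.

Lemma normc_le_ReIm z : cnorm z <= `|complex.Re z| + `|complex.Im z|.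
Proof.
rewrite -(@ler_pXn2r _ 2)// ?nnegrE ?normc_ge0 ?addr_ge0// normc_sqr sqrrD !real_normK ?num_real//.
by rewrite addrAC lerDl mulrn_wge0// mulr_ge0.
Qed.

(** The norm of [Cpx R] takes its values in [R[i]]; this is the access to its neighbourhoods through
    the real-valued modulus. *)
Lemma nbhs_Cpx (z : Cpx R) (e : R) : 0 < e -> \forall w \near z, cnorm (w - z : R[i]) < e.
Proof.
move=> e0; have ec0 : 0 < e%:C :> R[i] by rewrite ltcR.
apply/nbhs_ballP; exists (e%:C) => //= w; rewrite /ball /=.
by rewrite distrC /Num.norm /= ltcR.
Qed.

Lemma continuous_Re : continuous (fun z : Cpx R => complex.Re (z : R[i])).
Proof.
move=> z; apply/(@cvgrPdist_lt _ _ _ _ (@nbhs_filter (Cpx R) z)) => e e0.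
apply: (@filterS _ _ (@nbhs_filter (Cpx R) z) _ _ _ (nbhs_Cpx z e0)) => w; apply: le_lt_trans.
by rewrite distrC -ReB normr_Re_le.
Qed.

Lemma continuous_Im : continuous (fun z : Cpx R => complex.Im (z : R[i])).
Proof.
move=> z; apply/(@cvgrPdist_lt _ _ _ _ (@nbhs_filter (Cpx R) z)) => e e0.
apply: (@filterS _ _ (@nbhs_filter (Cpx R) z) _ _ _ (nbhs_Cpx z e0)) => w; apply: le_lt_trans.
by rewrite distrC -ImB normr_Im_le.
Qed.

Lemma continuous_Complex (T : topologicalType) (u v : T -> R) :
  continuous u -> continuous v -> continuous (fun x => (u x +i* v x) : Cpx R).
Proof.
(* The radius of a ball is a positive element of [R[i]], so its imaginary part is zero. *)
move=> cu cv x A /nbhs_ballP[[e1 e2]] /=; rewrite ltcE /= => /andP[/eqP -> e0] eA.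
have e20 : 0 < e1 / 2 by rewrite divr_gt0.
have /cvgrPdist_lt/(_ _ e20) hu := cu x.
have /cvgrPdist_lt/(_ _ e20) hv := cv x.
suff : \forall y \near x, A (u y +i* v y) by [].
apply: filterS (filterI hu hv) => y [hu' hv']; apply: eA.
rewrite /ball /= /Num.norm /= -/(cnorm _) ltcE /= eqxx /=.
have /= := normc_le_ReIm ((u x - u y) +i* (v x - v y)); move/le_lt_trans; apply.
by rewrite (splitr e1) ltrD.
Qed.

End complex_topology.

(** * Characters: joint continuity of evaluation, separation of the dual *)

Section characters.
Context (R : realType) (G : topologicalZmodType).
Hypotheses (hG : hausdorff_space G) (lcG : locally_compact [set: G]).

Lemma char_of_character (xi : dual R G) : @is_character R G (char_of xi).
Proof. exact: set_valP. Qed.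

(** Since [G] is locally compact and Hausdorff, a continuous family in the compact-open topology can
    be uncurried; here the family is the inclusion of the dual. *)
Lemma char_of_eval_continuous :
  continuous (fun p : dual R G * G => char_of p.1 p.2 : Cpx R).
Proof.
have -> : (fun p : dual R G * G => char_of p.1 p.2 : Cpx R) =
          uncurry (fun (xi : dual R G) (x : G) => (char_of xi x : Cpx R)).
  by apply/funext => -[].
apply: continuous_uncurry => //; first exact: initial_continuous.
by move=> xi; have [] := char_of_character xi.
Qed.

(** The real and imaginary parts of evaluations are continuous on the dual with values in the
    Hausdorff space [R], and together they separate characters. *)
Lemma dual_hausdorff : hausdorff_space (dual R G).
Proof.
have evc x : continuous (fun xi : dual R G => char_of xi x : Cpx R).
  move=> xi; apply: (@continuous_comp (dual R G) (dual R G * G)%type (Cpx R)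
      (fun eta => (eta, x)) (fun p => char_of p.1 p.2) xi).
    apply: (@cvg_pair _ _ _ (nbhs xi) (nbhs xi) (nbhs x) _ _ _ id (cst x)).
      exact: cvg_id.
    exact: cvg_cst.
  exact: char_of_eval_continuous.
move=> xi eta cl; apply: val_inj; apply/funext => x.
suff H (f : Cpx R -> R) : continuous f -> f (char_of xi x) = f (char_of eta x).
  have := H _ (@continuous_Re R); have := H _ (@continuous_Im R).
  change (complex.Im (char_of xi x) = complex.Im (char_of eta x) ->
    complex.Re (char_of xi x) = complex.Re (char_of eta x) -> char_of xi x = char_of eta x).
  by case: (char_of xi x) (char_of eta x) => [a b] [c d] /= -> ->.
move=> cf; apply: (@Rhausdorff R) => A B nA nB.
have cfev : continuous (fun zeta : dual R G => f (char_of zeta x)).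
  by move=> z; exact: (@continuous_comp (dual R G) (Cpx R) R _ f z (evc x z) (cf _)).
have [z [Az Bz]] := cl _ _ (cfev xi _ nA) (cfev eta _ nB).
by exists (f (char_of z x)).
Qed.

Lemma char_kernel_continuous (f : Cpx R -> R) : continuous f ->
  continuous (fun z : zpt G * dual R G => f (char_of z.2 z.1)).
Proof.
move=> cf [x xi].
apply: (@continuous_comp (zpt G * dual R G)%type (dual R G * G)%type R (fun z => (z.2, z.1 : G))
  (fun p => f (char_of p.1 p.2)) (x, xi)).
  apply: (@cvg_pair _ _ _ (nbhs (x, xi)) (nbhs xi) (nbhs (x : G)) _ _ _ snd fst).
    exact: cvg_snd.
  exact: cvg_fst.
have ce := @char_of_eval_continuous (xi, x : G).
exact: (@continuous_comp (dual R G * G)%type (Cpx R) R (fun p => char_of p.1 p.2) f (xi, x : G) ce (cf _)).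
Qed.

End characters.

(** * Complex-valued L1 and L2 functions *)

Section complex_functions.
Context (R : realType).
Implicit Types z w : R[i].

(* The real inner product Re (z conj w), which suffices to separate L2 functions. *)
Definition cdot z w : R := complex.Re z * complex.Re w + complex.Im z * complex.Im w.

Lemma cdotzz z : cdot z z = cnorm z ^+ 2.
Proof. by rewrite normc_sqr /cdot !expr2. Qed.

Lemma cdotBl z w v : cdot (z - w) v = cdot z v - cdot w v.
Proof. by rewrite /cdot ReB ImB; ring. Qed.

Lemma normc_polarization z w : cnorm (z + w) ^+ 2 - cnorm (z - w) ^+ 2 = 4 * cdot z w.
Proof. by case: z w => [a b] [c d]; rewrite !normc_sqr /cdot /=; ring. Qed.

Lemma normc_sqrD_le z w : cnorm (z + w) ^+ 2 <= 2 * cnorm z ^+ 2 + 2 * cnorm w ^+ 2.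
Proof.
case: z w => [a b] [c d]; rewrite !normc_sqr /= -subr_ge0.
have -> : 2 * (a ^+ 2 + b ^+ 2) + 2 * (c ^+ 2 + d ^+ 2) -
  ((a + c) ^+ 2 + (b + d) ^+ 2) = (a - c) ^+ 2 + (b - d) ^+ 2 by ring.
by rewrite addr_ge0// sqr_ge0.
Qed.

Lemma normc_sqrB_le z w : cnorm (z - w) ^+ 2 <= 2 * cnorm z ^+ 2 + 2 * cnorm w ^+ 2.
Proof. by rewrite (le_trans (normc_sqrD_le _ _))// normcN. Qed.

(** Young's inequality; the free parameter [t] does the work of Cauchy-Schwarz once integrated. *)
Lemma normr_cdot_le z w (t : R) : 0 < t ->
  2 * `|cdot z w| <= t * cnorm z ^+ 2 + t^-1 * cnorm w ^+ 2.
Proof.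
move=> t0; have t_neq0 : t != 0 by rewrite gt_eqF.
case: z w => [a b] [c d]; rewrite !normc_sqr /cdot /=.
(* Here [e] is the sign of [cdot z w]. The term in [1 - e ^+ 2] makes the completed square an
   identity for all [e], and then vanishes. *)
have h (e : R) : e ^+ 2 = 1 -> 2 * (e * (a * c + b * d)) <=
    t * (a ^+ 2 + b ^+ 2) + t^-1 * (c ^+ 2 + d ^+ 2).
  move=> e2; rewrite -subr_ge0.
  have -> : t * (a ^+ 2 + b ^+ 2) + t^-1 * (c ^+ 2 + d ^+ 2) - 2 * (e * (a * c + b * d)) =
    t * ((a - e * t^-1 * c) ^+ 2 + (b - e * t^-1 * d) ^+ 2) +
    t^-1 * (1 - e ^+ 2) * (c ^+ 2 + d ^+ 2) by field.
  by rewrite e2 subrr mulr0 mul0r addr0 mulr_ge0 ?addr_ge0 ?sqr_ge0// ltW.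
have [_|_] := ger0P (a * c + b * d).
  by rewrite -[X in 2 * X]mul1r h ?expr1n.
by rewrite -mulN1r h// sqrrN expr1n.
Qed.

(** By Lagrange's identity the difference of the squares is [(a * d - b * c) ^+ 2]. *)
Lemma normr_cdot_leM z w : `|cdot z w| <= cnorm z * cnorm w.
Proof.
rewrite -(@ler_pXn2r _ 2)// ?nnegrE ?mulr_ge0 ?normc_ge0// real_normK ?num_real// exprMn !normc_sqr.
case: z w => [a b] [c d]; rewrite /cdot /= -subr_ge0.
have -> : (a ^+ 2 + b ^+ 2) * (c ^+ 2 + d ^+ 2) - (a * c + b * d) ^+ 2 =
  (a * d - b * c) ^+ 2 by ring.
exact: sqr_ge0.
Qed.

Context d (T : measurableType d) (m : {measure set T -> \bar R}).
Implicit Types f g h : T -> R[i].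

Lemma cmeasurable_sqr f : cmeasurable f -> measurable_fun setT (fun x => cnorm (f x) ^+ 2).
Proof.
move=> [mr mi]; under eq_fun do rewrite normc_sqr.
by apply: measurable_funD; exact: measurable_funX.
Qed.

Lemma cmeasurable_norm f : cmeasurable f -> measurable_fun setT (fun x => cnorm (f x)).
Proof.
move=> mf; have -> : (fun x => cnorm (f x)) = Num.sqrt \o (fun x => cnorm (f x) ^+ 2).
  by apply/funext => x /=; rewrite sqrtr_sqr ger0_norm// normc_ge0.
by apply: measurableT_comp; [apply: continuous_measurable_fun; exact: sqrt_continuous|exact: cmeasurable_sqr].
Qed.

Lemma cmeasurableD f h : cmeasurable f -> cmeasurable h -> cmeasurable (fun x => f x + h x).
Proof.
move=> [fr fi] [hr hi]; split.
  rewrite (_ : (fun x => _) = (fun x => complex.Re (f x) + complex.Re (h x))).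
    exact: measurable_funD.
  by apply/funext => x; case: (f x) (h x) => [? ?] [].
rewrite (_ : (fun x => _) = (fun x => complex.Im (f x) + complex.Im (h x))).
  exact: measurable_funD.
by apply/funext => x; case: (f x) (h x) => [? ?] [].
Qed.

Lemma cmeasurableB f h : cmeasurable f -> cmeasurable h -> cmeasurable (fun x => f x - h x).
Proof.
move=> [fr fi] [hr hi]; split.
  by under eq_fun do rewrite ReB; exact: measurable_funB.
by under eq_fun do rewrite ImB; exact: measurable_funB.
Qed.

Lemma cmeasurable_cdot f h : cmeasurable f -> cmeasurable h ->
  measurable_fun setT (fun x => cdot (f x) (h x)).
Proof.
by move=> [fr fi] [hr hi]; apply: measurable_funD; exact: measurable_funM.
Qed.

(** Passes from finiteness of an extended-real integral to integrability, so that real-valued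
    integrals can be computed with. *)
Lemma L2cP f : L2c m f <->
  cmeasurable f /\ integrable_fct m (fun x => cnorm (f x) ^+ 2).
Proof.
have e : (\int[m]_x `|(EFin \o (fun x => (cnorm (f x) ^+ 2)%R)) x| = cpow_integral m 2 f)%E.
  by apply: eq_integral => x _ /=; rewrite ger0_norm// sqr_ge0.
split=> -[mf fi]; split=> //; last by rewrite -e; case/integrableP: fi.
apply/integrableP; split; last by rewrite e.
exact/measurable_EFinP/cmeasurable_sqr.
Qed.

Lemma L1cP f : L1c m f <->
  cmeasurable f /\ integrable_fct m (fun x => cnorm (f x)).
Proof.
have e : (\int[m]_x `|(EFin \o (fun x => cnorm (f x))) x| = cpow_integral m 1 f)%E.
  by apply: eq_integral => x _ /=; rewrite expr1 ger0_norm// normc_ge0.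
split=> -[mf fi]; split=> //; last by rewrite -e; case/integrableP: fi.
apply/integrableP; split; last by rewrite e.
exact/measurable_EFinP/cmeasurable_norm.
Qed.

Lemma L1c_Re f : L1c m f -> integrable_fct m (fun x => complex.Re (f x)).
Proof.
move=> /L1cP[[mr mi] fi]; apply: (integrable_fct_le mr _ fi) => x.
exact: normr_Re_le.
Qed.

Lemma L1c_Im f : L1c m f -> integrable_fct m (fun x => complex.Im (f x)).
Proof.
move=> /L1cP[[mr mi] fi]; apply: (integrable_fct_le mi _ fi) => x.
exact: normr_Im_le.
Qed.

Lemma L1c_le f (k : T -> R) : cmeasurable f -> integrable_fct m k ->
  (forall x, cnorm (f x) <= k x) -> L1c m f.
Proof.
move=> mf ki fk; apply/L1cP; split => //; apply: (integrable_fct_le _ _ ki).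
  exact: cmeasurable_norm.
by move=> x; rewrite ger0_norm// normc_ge0.
Qed.

Lemma L2c_le f (k : T -> R) : cmeasurable f -> integrable_fct m k ->
  (forall x, cnorm (f x) ^+ 2 <= k x) -> L2c m f.
Proof.
move=> mf ki fk; apply/L2cP; split => //; apply: (integrable_fct_le _ _ ki).
  exact: cmeasurable_sqr.
by move=> x; rewrite ger0_norm// sqr_ge0.
Qed.

Lemma L2cD f h : L2c m f -> L2c m h -> L2c m (fun x => f x + h x).
Proof.
move=> /L2cP[mf fi] /L2cP[mh hi]; apply: (L2c_le (k := fun x => 2 * cnorm (f x) ^+ 2 + 2 * cnorm (h x) ^+ 2)).
- exact: cmeasurableD.
- by apply: integrable_fctD; exact: integrable_fctZ.
- by move=> x; exact: normc_sqrD_le.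
Qed.

Lemma L2cB f h : L2c m f -> L2c m h -> L2c m (fun x => f x - h x).
Proof.
move=> /L2cP[mf fi] /L2cP[mh hi]; apply: (L2c_le (k := fun x => 2 * cnorm (f x) ^+ 2 + 2 * cnorm (h x) ^+ 2)).
- exact: cmeasurableB.
- by apply: integrable_fctD; exact: integrable_fctZ.
- by move=> x; exact: normc_sqrB_le.
Qed.

Lemma L1cD f h : L1c m f -> L1c m h -> L1c m (fun x => f x + h x).
Proof.
move=> /L1cP[mf fi] /L1cP[mh hi]; apply: (L1c_le _ (integrable_fctD fi hi)).
  exact: cmeasurableD.
by move=> x; exact: le_normcD.
Qed.

Lemma L1cB f h : L1c m f -> L1c m h -> L1c m (fun x => f x - h x).
Proof.
move=> /L1cP[mf fi] /L1cP[mh hi]; apply: (L1c_le _ (integrable_fctD fi hi)).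
  exact: cmeasurableB.
move=> x; apply: (le_trans (le_normcD _ _)).
by rewrite normcN.
Qed.

Lemma L2c_cdot f h : L2c m f -> L2c m h -> integrable_fct m (fun x => cdot (f x) (h x)).
Proof.
move=> /L2cP[mf fi] /L2cP[mh hi]; apply: (integrable_fct_le _ _ (integrable_fctD fi hi)).
  exact: cmeasurable_cdot.
move=> x; have := normr_cdot_le (f x) (h x) ltr01; rewrite invr1 !mul1r; apply: le_trans.
by rewrite ler_peMl// ler1n.
Qed.

Lemma Rintegral_cdotBl f g h : L2c m f -> L2c m g -> L2c m h ->
  \int[m]_x cdot (f x - g x) (h x) = \int[m]_x cdot (f x) (h x) - \int[m]_x cdot (g x) (h x).
Proof.
move=> f2 g2 h2; rewrite -RintegralB//; [|exact: L2c_cdot..].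
by apply: eq_Rintegral => x _; rewrite cdotBl.
Qed.

Lemma Rintegral_cdot_le f h (t : R) : L2c m f -> L2c m h -> 0 < t ->
  2 * `|\int[m]_x cdot (f x) (h x)| <=
  t * \int[m]_x (cnorm (f x) ^+ 2) + t^-1 * \int[m]_x (cnorm (h x) ^+ 2).
Proof.
move=> f2 h2 t0; have ci := L2c_cdot f2 h2.
move: f2 h2 => /L2cP[mf fi] /L2cP[mh hi].
rewrite -!RintegralZl// -RintegralD//; [|exact: integrable_fctZ..].
rewrite -ler_pdivlMl// -RintegralZl//; last first.
  by apply: integrable_fctD; exact: integrable_fctZ.
apply: Rintegral_norm_le => //.
  by apply: integrable_fctZ; apply: integrable_fctD; exact: integrable_fctZ.
by move=> x; rewrite ler_pdivlMl// normr_cdot_le.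
Qed.

Lemma Rintegral_polarization f h : L2c m f -> L2c m h ->
  \int[m]_x (cnorm (f x + h x) ^+ 2) - \int[m]_x (cnorm (f x - h x) ^+ 2) =
  4 * \int[m]_x cdot (f x) (h x).
Proof.
move=> f2 h2; have /L2cP[_ di] := L2cD f2 h2; have /L2cP[_ bi] := L2cB f2 h2.
rewrite -RintegralB// -RintegralZl//; last exact: L2c_cdot.
by apply: eq_Rintegral => x _; rewrite normc_polarization.
Qed.

End complex_functions.

(** * Fourier transform and inversion *)

Section fourier.
Context (R : realType) (G : topologicalZmodType).
Hypotheses (hG : hausdorff_space G) (lcG : locally_compact [set: G]).
Variables (mu : {measure set (borel_of (zpt G)) -> \bar R})
          (nu : {measure set (borel_of (dual R G)) -> \bar R}).
Hypotheses (rmu : radon mu) (rnu : radon nu).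

Let hG' : hausdorff_space (zpt G) := hG.
Let hD : hausdorff_space (dual R G) := dual_hausdorff hG lcG.

(** The transforms are split into integrals against these two real kernels, which are jointly
    continuous and bounded by 1 because characters are unimodular. *)
Let a (x : zpt G) (xi : dual R G) : R := complex.Re (char_of xi x).
Let b (x : zpt G) (xi : dual R G) : R := complex.Im (char_of xi x).

Let a_cont : continuous (fun z : zpt G * dual R G => a z.1 z.2).
Proof. exact: (char_kernel_continuous hG lcG (@continuous_Re R)). Qed.

Let b_cont : continuous (fun z : zpt G * dual R G => b z.1 z.2).
Proof. exact: (char_kernel_continuous hG lcG (@continuous_Im R)). Qed.

Let a_le1 x xi : `|a x xi| <= 1.
Proof.
have [_ _ /(_ x) <-] := char_of_character xi; exact: normr_Re_le.
Qed.

Let b_le1 x xi : `|b x xi| <= 1.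
Proof.
have [_ _ /(_ x) <-] := char_of_character xi; exact: normr_Im_le.
Qed.

Let a_cont' : continuous (fun z : dual R G * zpt G => a z.2 z.1).
Proof. exact: (kernel_flip_cont a_cont). Qed.

Let b_cont' : continuous (fun z : dual R G * zpt G => b z.2 z.1).
Proof. exact: (kernel_flip_cont b_cont). Qed.

Let intX (phi : zpt G -> dual R G -> R) (k : zpt G -> R) xi : continuous (fun z : zpt G * dual R G => phi z.1 z.2) ->
  (forall x xi, `|phi x xi| <= 1) -> integrable_fct mu k ->
  integrable_fct mu (fun x => phi x xi * k x).
Proof. by move=> c l; exact: kernel_integrable. Qed.

Lemma Re_fourier (h : zpt G -> R[i]) xi : L1c mu h -> complex.Re (fourier mu h xi) =
  \int[mu]_x (a x xi * complex.Re (h x)) + \int[mu]_x (b x xi * complex.Im (h x)).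
Proof.
move=> h1; have hr := L1c_Re h1; have hi := L1c_Im h1.
rewrite -RintegralD//; [|exact: intX..]; apply: eq_Rintegral => x _.
by rewrite ReM /a /b; case: (char_of xi x) => p q /=; rewrite mulNr opprK.
Qed.

Lemma Im_fourier (h : zpt G -> R[i]) xi : L1c mu h -> complex.Im (fourier mu h xi) =
  \int[mu]_x (a x xi * complex.Im (h x)) - \int[mu]_x (b x xi * complex.Re (h x)).
Proof.
move=> h1; have hr := L1c_Re h1; have hi := L1c_Im h1.
rewrite -RintegralB//; [|exact: intX..]; apply: eq_Rintegral => x _.
by rewrite ImM /a /b; case: (char_of xi x) => p q /=; rewrite mulNr.
Qed.

(** The transform of an [L1] function is continuous. *)
Lemma fourier_cmeasurable (h : zpt G -> R[i]) : L1c mu h ->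
  cmeasurable (fourier mu h : borel_of (dual R G) -> R[i]).
Proof.
move=> h1; have hr := L1c_Re h1; have hi := L1c_Im h1; split.
  under eq_fun do rewrite Re_fourier//.
  by apply: measurable_funD; apply: continuous_borel_measurable; exact: transform_continuous.
under eq_fun do rewrite Im_fourier//.
by apply: measurable_funB; apply: continuous_borel_measurable; exact: transform_continuous.
Qed.

Lemma fourierD (f h : zpt G -> R[i]) xi : L1c mu f -> L1c mu h ->
  fourier mu (fun x => f x + h x) xi = fourier mu f xi + fourier mu h xi.
Proof.
move=> f1 h1; have fh1 := L1cD f1 h1.
have h1r := L1c_Re h1; have h1i := L1c_Im h1.
have f1r := L1c_Re f1; have f1i := L1c_Im f1.
have tD (k k' : zpt G -> R) : integrable_fct mu k -> integrable_fct mu k' ->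
   \int[mu]_x (a x xi * (k x + k' x)) =
     \int[mu]_x (a x xi * k x) + \int[mu]_x (a x xi * k' x) /\
   \int[mu]_x (b x xi * (k x + k' x)) =
     \int[mu]_x (b x xi * k x) + \int[mu]_x (b x xi * k' x).
  by move=> ki ki'; split; exact: transformD.
have [rA rB] := tD _ _ f1r h1r; have [iA iB] := tD _ _ f1i h1i.
have E1 : complex.Re (fourier mu (fun x => f x + h x) xi) =
    complex.Re (fourier mu f xi) + complex.Re (fourier mu h xi).
  rewrite !Re_fourier//.
  under eq_Rintegral do rewrite ReD; rewrite rA.
  by under [X in _ + X = _]eq_Rintegral do rewrite ImD; rewrite iB addrACA.
have E2 : complex.Im (fourier mu (fun x => f x + h x) xi) =
    complex.Im (fourier mu f xi) + complex.Im (fourier mu h xi).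
  rewrite !Im_fourier//.
  under eq_Rintegral do rewrite ImD; rewrite iA.
  by under [X in _ - X = _]eq_Rintegral do rewrite ReD; rewrite rB opprD addrACA.
move: E1 E2; case: (fourier _ _ _) (fourier mu f xi) (fourier mu h xi) => [? ?] [? ?] [? ?] /=.
by move=> -> ->.
Qed.

Lemma fourierB (f h : zpt G -> R[i]) xi : L1c mu f -> L1c mu h ->
  fourier mu (fun x => f x - h x) xi = fourier mu f xi - fourier mu h xi.
Proof.
move=> f1 h1; have := fourierD xi (L1cB f1 h1) h1.
under [in X in X = _]eq_fun do rewrite subrK.
by move=> ->; rewrite addrK.
Qed.

(** Applied to the transform of [f], this is the continuous representative sought. *)
Definition inv_fourier (F : dual R G -> R[i]) (x : zpt G) : R[i] :=
  cintegral nu (fun xi : borel_of (dual R G) => char_of xi x * F xi).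

Let intY (phi : zpt G -> dual R G -> R) (k : dual R G -> R) x : continuous (fun z : dual R G * zpt G => phi z.2 z.1) ->
  (forall x xi, `|phi x xi| <= 1) -> integrable_fct nu k ->
  integrable_fct nu (fun xi => phi x xi * k xi).
Proof.
move=> c l; apply: (@kernel_integrable _ _ _ nu (fun xi x => phi x xi)) => //.
Qed.

Lemma Re_inv_fourier F x : L1c nu F -> complex.Re (inv_fourier F x) =
  \int[nu]_xi (a x xi * complex.Re (F xi)) - \int[nu]_xi (b x xi * complex.Im (F xi)).
Proof.
move=> h1; have hr := L1c_Re h1; have hi := L1c_Im h1.
rewrite -RintegralB//; [|exact: intY..]; apply: eq_Rintegral => xi _.
by rewrite ReM.
Qed.

Lemma Im_inv_fourier F x : L1c nu F -> complex.Im (inv_fourier F x) =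
  \int[nu]_xi (a x xi * complex.Im (F xi)) + \int[nu]_xi (b x xi * complex.Re (F xi)).
Proof.
move=> h1; have hr := L1c_Re h1; have hi := L1c_Im h1.
rewrite -RintegralD//; [|exact: intY..]; apply: eq_Rintegral => xi _.
by rewrite ImM.
Qed.

Lemma inv_fourier_continuous_Re F : L1c nu F ->
  continuous (fun x => complex.Re (inv_fourier F x)).
Proof.
move=> h1; have hr := L1c_Re h1; have hi := L1c_Im h1.
under eq_fun do rewrite Re_inv_fourier//.
move=> x; apply: (@cvgB _ R).
  exact: (transform_continuous a_cont' _ hD rnu hr).
exact: (transform_continuous b_cont' _ hD rnu hi).
Qed.

Lemma inv_fourier_continuous_Im F : L1c nu F ->
  continuous (fun x => complex.Im (inv_fourier F x)).
Proof.
move=> h1; have hr := L1c_Re h1; have hi := L1c_Im h1.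
under eq_fun do rewrite Im_inv_fourier//.
move=> x; apply: (@cvgD _ R).
  exact: (transform_continuous a_cont' _ hD rnu hi).
exact: (transform_continuous b_cont' _ hD rnu hr).
Qed.

Lemma inv_fourier_continuous F : L1c nu F -> continuous (inv_fourier F : zpt G -> Cpx R).
Proof.
move=> h1; exact: (continuous_Complex (inv_fourier_continuous_Re h1) (inv_fourier_continuous_Im h1)).
Qed.

Lemma inv_fourier_cmeasurable F : L1c nu F ->
  cmeasurable (inv_fourier F : borel_of (zpt G) -> R[i]).
Proof.
move=> h1; split; apply: continuous_borel_measurable.
  exact: inv_fourier_continuous_Re.
exact: inv_fourier_continuous_Im.
Qed.

(** The factor 2 comes from bounding the real and imaginary parts separately. *)
Lemma inv_fourier_le F x : L1c nu F ->
  cnorm (inv_fourier F x) <= 2 * \int[nu]_xi cnorm (F xi).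
Proof.
move=> F1; have /L1cP[mF Fi] := F1; have hr := L1c_Re F1; have hi := L1c_Im F1.
have e xi : cnorm (char_of xi x * F xi) = cnorm (F xi).
  rewrite ComplexField.Normc.normcM; have [_ _ ->] := char_of_character xi.
  by rewrite mul1r.
apply: (le_trans (normc_le_ReIm _)); rewrite mulr_natl mulr2n lerD//.
  apply: Rintegral_norm_le => //.
    under eq_fun do rewrite ReM.
    exact: (integrable_fctB (intY x a_cont' a_le1 hr) (intY x b_cont' b_le1 hi)).
  by move=> xi; rewrite -e normr_Re_le.
apply: Rintegral_norm_le => //.
  under eq_fun do rewrite ImM.
  exact: (integrable_fctD (intY x a_cont' a_le1 hi) (intY x b_cont' b_le1 hr)).
by move=> xi; rewrite -e normr_Im_le.
Qed.

(** The two transforms are adjoint. Expanding [cdot] yields four pairings with the real kernels, and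
    [kernel_swap] exchanges the integrals in each. *)
Lemma fourier_duality F (h : zpt G -> R[i]) : L1c nu F -> L1c mu h ->
  \int[nu]_xi cdot (F xi) (fourier mu h xi) = \int[mu]_x cdot (inv_fourier F x) (h x).
Proof.
move=> F1 h1; have Fr := L1c_Re F1; have Fi := L1c_Im F1.
have hr := L1c_Re h1; have hi := L1c_Im h1.
have ja := kernel_pairing_integrable a_cont a_le1 hG' rmu.
have jb := kernel_pairing_integrable b_cont b_le1 hG' rmu.
have ja' := kernel_pairing_integrable a_cont' (fun xi x => a_le1 x xi) hD rnu.
have jb' := kernel_pairing_integrable b_cont' (fun xi x => b_le1 x xi) hD rnu.
have sa := kernel_swap a_cont a_le1 hG' rmu hD rnu.
have sb := kernel_swap b_cont b_le1 hG' rmu hD rnu.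
rewrite /cdot.
transitivity (\int[nu]_xi ((\int[mu]_x (a x xi * complex.Re (h x)) * complex.Re (F xi)
   + \int[mu]_x (b x xi * complex.Im (h x)) * complex.Re (F xi))
   + (\int[mu]_x (a x xi * complex.Im (h x)) * complex.Im (F xi)
   - \int[mu]_x (b x xi * complex.Re (h x)) * complex.Im (F xi)))).
  by apply: eq_Rintegral => xi _; rewrite Re_fourier// Im_fourier//; ring.
have i1 := ja _ _ _ hr Fr; have i2 := jb _ _ _ hi Fr.
have i3 := ja _ _ _ hi Fi; have i4 := jb _ _ _ hr Fi.
rewrite RintegralD//; [|exact: integrable_fctD|exact: integrable_fctB].
rewrite RintegralD// RintegralB// !sa// !sb//.
have j1 := ja' _ _ _ Fr hr; have j2 := jb' _ _ _ Fr hi.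
have j3 := ja' _ _ _ Fi hi; have j4 := jb' _ _ _ Fi hr.
rewrite -RintegralD// -RintegralB// -RintegralD//; [|exact: integrable_fctD|exact: integrable_fctB].
by apply: eq_Rintegral => x _; rewrite Re_inv_fourier// Im_inv_fourier//; ring.
Qed.

Hypothesis hpl : plancherel_normalized mu nu.

Lemma fourier_L2c (h : zpt G -> R[i]) : L1c mu h -> L2c mu h ->
  L2c nu (fourier mu h : borel_of (dual R G) -> R[i]).
Proof.
move=> h1 h2; split; first exact: fourier_cmeasurable.
by have := hpl h1 h2 => <-; case: h2.
Qed.

Lemma plancherel_Rintegral (h : zpt G -> R[i]) : L1c mu h -> L2c mu h ->
  \int[mu]_x (cnorm (h x) ^+ 2) = \int[nu]_xi (cnorm (fourier mu h xi) ^+ 2).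
Proof. by move=> h1 h2; congr fine; exact: hpl. Qed.

(** Polarization: Plancherel's identity is applied to the sum and the difference of [f] and [h]. *)
Lemma parseval (f h : zpt G -> R[i]) : L1c mu f -> L2c mu f -> L1c mu h -> L2c mu h ->
  \int[mu]_x cdot (f x) (h x) = \int[nu]_xi cdot (fourier mu f xi) (fourier mu h xi).
Proof.
move=> f1 f2 h1 h2; apply: (@mulfI R 4) => //.
rewrite -!Rintegral_polarization//; [|exact: fourier_L2c..].
rewrite (plancherel_Rintegral (L1cD f1 h1) (L2cD f2 h2)).
rewrite (plancherel_Rintegral (L1cB f1 h1) (L2cB f2 h2)).
by congr (_ - _); apply: eq_Rintegral => xi _; [rewrite fourierD|rewrite fourierB].
Qed.

End fourier.

(** * A weighted Cauchy-Schwarz inequality *)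

Section weighted_L1.
Context d (T : measurableType d) (R : realType) (m : {measure set T -> \bar R}).
Variables (p : T -> R) (F : T -> R[i]).
Hypotheses (p0 : forall x, 0 < p x) (pi : integrable_fct m p) (mF : cmeasurable F).
Hypothesis Fi : integrable_fct m (fun x => (p x)^-1 * cnorm (F x) ^+ 2).

Let S := \int[m]_x ((p x)^-1 * cnorm (F x) ^+ 2).

(** The difference of the two sides is [t * p x] times a square. With [p] the inverse Sobolev
    weight, the last term is the integrand of the Sobolev norm. *)
Lemma weighted_AMGM x (t : R) : 0 < t ->
  2 * cnorm (F x) <= t * p x + t^-1 * ((p x)^-1 * cnorm (F x) ^+ 2).
Proof.
move=> t0; have px := p0 x; rewrite -subr_ge0.
have t1 : t != 0 by rewrite gt_eqF.
have p1 : p x != 0 by rewrite gt_eqF.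
have -> : t * p x + t^-1 * ((p x)^-1 * cnorm (F x) ^+ 2) - 2 * cnorm (F x) =
  t * p x * (1 - cnorm (F x) * (t^-1 * (p x)^-1)) ^+ 2 by field; rewrite t1 p1.
by rewrite mulr_ge0 ?sqr_ge0// mulr_ge0// ltW.
Qed.

Lemma weighted_L1c : L1c m F.
Proof.
apply: (L1c_le mF (integrable_fctD pi Fi)) => x.
have := weighted_AMGM x ltr01; rewrite invr1 !mul1r; apply: le_trans.
by rewrite ler_peMl ?normc_ge0// ler1n.
Qed.

(** Integrating [weighted_AMGM] and taking [t] close to the root of [S] gives this constant, weaker
    than the one of Cauchy-Schwarz but free of a second square root. *)
Lemma weighted_L1_le :
  2 * \int[m]_x cnorm (F x) <= (\int[m]_x p x + 1) * Num.sqrt S.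
Proof.
have /L1cP[_ F1] := weighted_L1c.
have S0 : 0 <= S.
  by apply: Rintegral_ge0 => x _; rewrite mulr_ge0 ?invr_ge0 ?sqr_ge0// ltW.
have A0 : 0 <= \int[m]_x p x by apply: Rintegral_ge0 => x _; exact: ltW.
set A := \int[m]_x p x in A0 *.
have main (t : R) : 0 < t -> 2 * \int[m]_x cnorm (F x) <= t * A + t^-1 * S.
  move=> t0; rewrite /A /S -!RintegralZl// -RintegralD//; [|exact: integrable_fctZ..].
  apply: le_Rintegral => //; first exact: integrable_fctZ.
    by apply: integrable_fctD; exact: integrable_fctZ.
  by move=> x _; exact: weighted_AMGM.
apply/ler_addgt0Pr => e e0.
(* The shift [r] keeps [t] positive when [S] is zero and costs at most [e]. *)
pose r := e / (A + 1); have r0 : 0 < r by rewrite divr_gt0// ltr_wpDl.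
have t0 : 0 < Num.sqrt S + r by rewrite ltr_wpDl// sqrtr_ge0.
apply: (le_trans (main _ t0)); rewrite -/A.
have h1 : A * r <= e.
  have A1 : 0 < A + 1 by rewrite ltr_wpDl.
  by rewrite /r mulrA ler_pdivrMr// mulrC ler_wpM2l ?lerDl// ltW.
have h2 : (Num.sqrt S + r)^-1 * S <= Num.sqrt S.
  rewrite mulrC ler_pdivrMr// -{1}(sqr_sqrtr S0) expr2 ler_wpM2l ?sqrtr_ge0//.
  by rewrite lerDl ltW.
have -> : (Num.sqrt S + r) * A + (Num.sqrt S + r)^-1 * S =
  A * Num.sqrt S + ((Num.sqrt S + r)^-1 * S + A * r) by ring.
have -> : (A + 1) * Num.sqrt S + e = A * Num.sqrt S + (Num.sqrt S + e) by ring.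
by rewrite lerD2l lerD.
Qed.

End weighted_L1.

(** * Fourier inversion almost everywhere *)

Section inversion.
Context (R : realType) (G : topologicalZmodType).
Hypotheses (hG : hausdorff_space G) (lcG : locally_compact [set: G]).
Variables (mu : {measure set (borel_of (zpt G)) -> \bar R})
          (nu : {measure set (borel_of (dual R G)) -> \bar R}).
Hypotheses (rmu : radon mu) (rnu : radon nu) (hpl : plancherel_normalized mu nu).

Variables (f : zpt G -> R[i]) (F : dual R G -> R[i]).
Hypotheses (f2 : L2c mu f) (fF : is_fourier_L2 mu nu f F) (F2 : L2c nu F).

(** Parseval's identity holds for the approximants [fn n], and both sides converge in [L2]. *)
Lemma parseval_L2 (h : zpt G -> R[i]) : L1c mu h -> L2c mu h ->
  \int[mu]_x cdot (f x) (h x) = \int[nu]_xi cdot (F xi) (fourier mu h xi).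
Proof.
move=> h1 h2; have [_ [fn [fn12 fnf fnF]]] := fF.
have hh2 := fourier_L2c hG lcG rmu hpl h1 h2.
pose A n := \int[mu]_x (cnorm (fn n x - f x) ^+ 2).
pose B n := \int[nu]_xi (cnorm (fourier mu (fn n) xi - F xi) ^+ 2).
have {}fnf : A n @[n --> \oo] --> 0 by have /fine_cvgP[] := fnf.
have {}fnF : B n @[n --> \oo] --> 0 by have /fine_cvgP[] := fnF.
set H := \int[mu]_x (cnorm (h x) ^+ 2).
have H0 : 0 <= H by apply: Rintegral_ge0 => x _; exact: sqr_ge0.
have HE : H = \int[nu]_x (cnorm (fourier mu h x) ^+ 2) by exact: plancherel_Rintegral.
apply/eqP; rewrite -subr_eq0 -normr_le0.
set D := _ - _.
(* [D] is the difference of the approximation errors on the two sides. Each is bounded by Young's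
   inequality, with the same [H] by Plancherel. *)
have main n (t : R) : 0 < t -> 2 * `|D| <= t * (A n + B n) + 2 * (t^-1 * H).
  move=> t0; have [n1 n2] := fn12 n.
  have nF2 := fourier_L2c hG lcG rmu hpl n1 n2.
  have e1 := Rintegral_cdot_le (L2cB n2 f2) h2 t0.
  have e2 := Rintegral_cdot_le (L2cB nF2 F2) hh2 t0.
  rewrite Rintegral_cdotBl// in e1; rewrite Rintegral_cdotBl// in e2.
  have pp := parseval hG lcG rmu hpl n1 n2 h1 h2.
  rewrite -/(A n) -/H in e1; rewrite -/(B n) -HE in e2.
  have -> : D = (\int[nu]_xi cdot (fourier mu (fn n) xi) (fourier mu h xi) - \int[nu]_xi cdot (F xi) (fourier mu h xi))
     - (\int[mu]_x cdot (fn n x) (h x) - \int[mu]_x cdot (f x) (h x)) by rewrite -pp /D; ring.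
  have -> : t * (A n + B n) + 2 * (t^-1 * H) = (t * B n + t^-1 * H) + (t * A n + t^-1 * H) by ring.
  apply: le_trans (lerD e2 e1).
  by rewrite -mulrDr ler_wpM2l// ler_normB.
apply/ler_addgt0Pr => e e0; rewrite add0r.
(* First [t] is taken large enough that [t^-1 * H] is at most [e / 3]; then [n] is taken so large
   that the approximation errors, multiplied by [t], contribute at most [e / 3]. *)
pose t := (H + 1) / (e / 3).
have e30 : 0 < e / 3 by rewrite divr_gt0.
have t0 : 0 < t by rewrite divr_gt0// ltr_wpDl.
have u0 : 0 < e / 6 / t by apply: divr_gt0 => //; exact: divr_gt0.
have [N _ /(_ N (leqnn N)) [hA hB]] : \forall n \near \oo, A n < e / 6 / t /\ B n < e / 6 / t.
  move/cvgrPdist_lt : fnf => /(_ _ u0) h1'; move/cvgrPdist_lt : fnF => /(_ _ u0) h2'.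
  apply: filterS (filterI h1' h2') => n [/= l1 l2].
  by rewrite !sub0r !normrN in l1 l2; split; apply: le_lt_trans (ler_norm _) _.
have := main N t t0.
have ht : t^-1 * H <= e / 3.
  rewrite /t invf_div mulrAC ler_pdivrMr ?ltr_wpDl// ler_wpM2l ?lerDl//; exact: ltW.
have hAB : t * (A N + B N) <= e / 3.
  rewrite mulrC -ler_pdivlMr//; apply: (le_trans (ltW (ltrD hA hB))).
  by rewrite -mulrDl ler_wpM2r ?invr_ge0 ?(ltW t0)//; lra.
lra.
Qed.

Hypothesis F1 : L1c nu F.
Let g := inv_fourier nu F.
Let C := 2 * \int[nu]_xi cnorm (F xi).

(* Testing Parseval against [h = (f - g) 1_E] makes the pairing of [f - g]
   with [h] the integral of |f - g|^2 over [E]. *)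
Lemma inversion_finite (E : set (borel_of (zpt G))) : measurable E -> (mu E < +oo)%E ->
  {ae mu, forall x : borel_of (zpt G), E x -> f x = g x}.
Proof.
move=> mE Efin; have [mf _] := f2.
have mg := inv_fourier_cmeasurable hG lcG rnu F1.
have g_le x : cnorm (g x) <= C := inv_fourier_le hG lcG x F1.
have mfg := cmeasurableB mf mg.
pose h x : R[i] := Complex (\1_E x * complex.Re (f x - g x)) (\1_E x * complex.Im (f x - g x)).
have iE := integrable_fct_indic mE Efin.
have mh : cmeasurable (h : borel_of (zpt G) -> R[i]).
  by case: mfg => mr mi; split; apply: measurable_funM => //; exact: measurable_indic.
have hE x : E x -> h x = f x - g x.
  by move=> Ex; rewrite /h indicE mem_set// !mul1r; case: (_ - _).
have hNE x : ~ E x -> h x = 0 by move=> Ex; rewrite /h indicE memNset// !mul0r.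
(* Square-integrability of [g] is only available on [E], where [g] is bounded by [C] and the measure
   is finite. *)
have h2 : L2c mu h.
  have /L2cP[_ fi] := f2.
  apply: (L2c_le mh (integrable_fctD (integrable_fctZ 2 fi) (integrable_fctZ (2 * C ^+ 2) iE))) => x.
  have [Ex|nEx] := pselect (E x); last first.
    rewrite hNE// ComplexField.Normc.normc0 expr0n /= indicE.
    apply: addr_ge0; first by apply: mulr_ge0 => //; exact: sqr_ge0.
    by apply: mulr_ge0; [apply: mulr_ge0 => //; exact: sqr_ge0|exact: ler0n].
  rewrite hE// (le_trans (normc_sqrB_le _ _))// lerD2l indicE mem_set// mulr1.
  by rewrite ler_wpM2l// ler_sqr ?nnegrE ?normc_ge0// (le_trans (normc_ge0 _) (g_le x)).
have h1 : L1c mu h.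
  have /L2cP[_ hi] := h2.
  (* On [E], a nonnegative number is at most 1 plus its square. *)
  apply: (L1c_le mh (integrable_fctD iE hi)) => x.
  have [Ex|nEx] := pselect (E x); last first.
    by rewrite hNE// ComplexField.Normc.normc0 expr0n /= indicE addr0 ler0n.
  rewrite indicE mem_set//; have := sqr_ge0 (cnorm (h x) - 1); have := normc_ge0 (h x).
  by move=> /= q0 q1; nra.
have : \int[mu]_x cdot (f x) (h x) - \int[mu]_x cdot (g x) (h x) = 0.
  rewrite parseval_L2//.
  have := fourier_duality hG lcG rmu rnu F1 h1; rewrite -/g => ->.
  by rewrite subrr.
have ci : integrable_fct mu (fun x => cdot (g x) (h x)).
  have /L1cP[_ hi] := h1.
  apply: (integrable_fct_le _ _ (integrable_fctZ C hi)).
    exact: cmeasurable_cdot.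
  move=> x; apply: (le_trans (normr_cdot_leM _ _)).
  by rewrite ler_wpM2r ?normc_ge0.
rewrite -RintegralB//; last exact: L2c_cdot.
rewrite (_ : \int[mu]_x _ = \int[mu]_x (cnorm (h x) ^+ 2)); last first.
  apply: eq_Rintegral => x _; rewrite -cdotBl -cdotzz.
  have [Ex|nEx] := pselect (E x); first by rewrite hE.
  by rewrite hNE// /cdot !mulr0.
have /L2cP[_ hi] := h2.
move=> int0.
have /ae_eq_integral_abs : measurable_fun setT (EFin \o (fun x => cnorm (h x) ^+ 2)).
  exact: measurable_int hi.
move=> /(_ mu measurableT) [+ _].
have -> : (\int[mu]_x `|(EFin \o (fun x => (cnorm (h x) ^+ 2)%R)) x| = 0)%E.
  rewrite -[RHS]/(0%R%:E) -int0 EFin_Rintegral//.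
  by apply: eq_integral => x _ /=; rewrite ger0_norm// sqr_ge0.
move=> /(_ erefl); apply: filterS => x /(_ I) /= [] /eqP.
rewrite sqrf_eq0 => /eqP h0 Ex; have hx : h x = 0 by exact: ComplexField.Normc.eq0_normc.
by apply/eqP; rewrite -subr_eq0 -hE// hx.
Qed.

(* Only the inner regularity on open sets is available for sets of a priori
   infinite measure, whence the bound through compact subsets. *)
Lemma inversion_level_lty (a : R) : 0 < a ->
  (mu [set x : zpt G | (a < cnorm (g x) ^+ 2)%R] < +oo)%E.
Proof.
move=> a0; have /L2cP[mf fi] := f2.
have mg := inv_fourier_cmeasurable hG lcG rnu F1.
have cg2 : continuous (fun x => cnorm (g x) ^+ 2).
  have cr := inv_fourier_continuous_Re hG lcG rnu F1.
  have ci := inv_fourier_continuous_Im hG lcG rnu F1.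
  under eq_fun do rewrite normc_sqr !expr2.
  by move=> x; apply: (@cvgD _ R); apply: (@cvgM R); [exact: cr|exact: cr|exact: ci|exact: ci].
have oU : open [set x : zpt G | a < cnorm (g x) ^+ 2].
  rewrite (_ : [set _ | _] = (fun x => cnorm (g x) ^+ 2) @^-1` [set r | a < r]).
    by apply: open_comp; [move=> x _; exact: cg2|exact: open_gt].
  by [].
have [Kfin _ ->] := rmu; last exact: oU.
(* On a compact [K] inside the level set [f] equals [g] almost everywhere, so [a] times the measure
   of [K] is at most the integral of [|f|^2]. *)
apply: (@le_lt_trans _ _ (a^-1 * \int[mu]_x (cnorm (f x) ^+ 2))%:E); last exact: ltry.
apply: ge_ereal_sup => _ [K [cK KU] <-].
have mK := borel_compact (hG : hausdorff_space (zpt G)) cK.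
have Kf := Kfin _ cK.
have iK := integrable_fct_indic mK Kf.
have : (\int[mu]_x (a * \1_K x)%:E <= \int[mu]_x (cnorm (f x) ^+ 2)%:E)%E.
  apply: ae_ge0_le_integral => //.
  - by move=> x _; rewrite lee_fin mulr_ge0 ?(ltW a0)// indicE ler0n.
  - exact: (measurable_int _ (integrable_fctZ a iK)).
  - by move=> x _; rewrite lee_fin sqr_ge0.
  - exact: (measurable_int _ fi).
  apply: filterS (inversion_finite mK Kf) => x fg _; rewrite lee_fin indicE.
  have [xK|xK] := boolP (x \in K); last by rewrite mulr0 sqr_ge0.
  by rewrite mulr1; rewrite inE in xK; rewrite fg// ltW// KU.
rewrite -(EFin_Rintegral (integrable_fctZ a iK)) -(EFin_Rintegral fi) lee_fin.
rewrite RintegralZl// /Rintegral integral_indic// setIT -/(Rintegral _ _ _).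
by rewrite -ler_pdivlMl// -lee_fin fineK// ge0_fin_numE.
Qed.

(** Wherever [f] or [g] is nonzero the point lies in some [A n] or [B n]. These have finite measure,
    by Markov's inequality for [f] and by [inversion_level_lty] for [g], so [inversion_finite]
    applies to each. *)
Lemma inversion_ae : {ae mu, forall x : borel_of (zpt G), f x = g x}.
Proof.
have /L2cP[mf fi] := f2.
have mg := inv_fourier_cmeasurable hG lcG rnu F1.
have a0 n : 0 < n.+1%:R^-1 :> R by rewrite invr_gt0.
pose A n : set (borel_of (zpt G)) := [set x | n.+1%:R^-1 <= `|cnorm (f x) ^+ 2|].
pose B n : set (borel_of (zpt G)) := [set x | n.+1%:R^-1 < cnorm (g x) ^+ 2].
have mA n : measurable (A n).
  rewrite (_ : A n = (fun x => `|cnorm (f x) ^+ 2|) @^-1` `[n.+1%:R^-1, +oo[%classic).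
    rewrite -[X in measurable X]setTI; apply: measurableT_comp => //.
    exact: cmeasurable_sqr.
  by apply/seteqP; split => x /=; rewrite in_itv /= andbT.
have mB n : measurable (B n).
  rewrite (_ : B n = (fun x => cnorm (g x) ^+ 2) @^-1` `]n.+1%:R^-1, +oo[%classic).
    by rewrite -[X in measurable X]setTI; exact: cmeasurable_sqr.
  by apply/seteqP; split => x /=; rewrite in_itv /= andbT.
have fA n := inversion_finite (mA n) (integrable_level_lty (a0 n) fi).
have fB n := inversion_finite (mB n) (inversion_level_lty (a0 n)).
have small (r : R) : 0 < r -> exists n : nat, n.+1%:R^-1 < r.
  move=> r0; have [n _ /(_ n (leqnn n))] : \forall n \near \oo, r^-1 <= n%:R by exact: nbhs_infty_ger.
  move=> h; exists n; rewrite -[ltRHS]invrK ltf_pV2 ?posrE ?invr_gt0//.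
  by rewrite (le_lt_trans h)// ltr_nat.
apply: filterS (filterI (ae_foralln fA) (ae_foralln fB)) => x [hA hB].
have [f0|f0] := eqVneq (f x) 0; last first.
  have /small[n hn] : 0 < cnorm (f x) ^+ 2.
    rewrite lt_neqAle sqr_ge0 andbT eq_sym sqrf_eq0; apply: contraNneq f0.
    by move=> /ComplexField.Normc.eq0_normc ->.
  by apply: (hA n); rewrite /A /= ger0_norm ?sqr_ge0// ltW.
have [g0|g0] := eqVneq (g x) 0; first by rewrite f0 g0.
have /small[n hn] : 0 < cnorm (g x) ^+ 2.
  rewrite lt_neqAle sqr_ge0 andbT eq_sym sqrf_eq0; apply: contraNneq g0.
  by move=> /ComplexField.Normc.eq0_normc ->.
exact: (hB n).
Qed.

End inversion.

(** * The Sobolev embedding *)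

Theorem theorem1 (R : realType) (G : topologicalZmodType)
    (hG : hausdorff_space G) (lcG : locally_compact [set: G])
    (mu : {measure set (borel_of (zpt G)) -> \bar R})
    (nu : {measure set (borel_of (dual R G)) -> \bar R})
    (hmu : haar_measure mu) (hnu : dual_haar_measure nu)
    (hpl : plancherel_normalized mu nu)
    (gamma : dual R G -> R) (hgamma : in_Gamma gamma) (s : R) (hs : 0 <= s)
    (hint : nu.-integrable setT
              (fun xi => ((1 + gamma xi ^+ 2) `^ (- s))%:E)) :
  exists C : R, forall (f : G -> R[i]) (F : dual R G -> R[i]),
    L2c mu f -> is_fourier_L2 mu nu f F ->
    (sobolev_norm2 nu gamma s F < +oo)%E ->
    exists g : G -> R[i],
      [/\ continuous (g : G -> Cpx R),
          {ae mu, forall x : borel_of G, g x = f x}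
        & forall x : G, cnorm (g x) <= C * Num.sqrt (fine (sobolev_norm2 nu gamma s F))].
Proof.
have [rmu _ _] := hmu; have [rnu _ _] := hnu.
pose p (xi : borel_of (dual R G)) := (1 + gamma xi ^+ 2) `^ (- s).
(* The constant of [weighted_L1_le], whose factor 2 absorbs the one of [inv_fourier_le]. *)
exists (\int[nu]_xi p xi + 1) => f F f2 fF Sfin.
have q1 xi : 1 <= 1 + gamma xi ^+ 2 by rewrite lerDl sqr_ge0.
have p0 xi : 0 < p xi by rewrite powR_gt0// (lt_le_trans ltr01).
have pE xi : (p xi)^-1 = (1 + gamma xi ^+ 2) `^ s by rewrite /p powRN invrK.
have p1 xi : 1 <= (p xi)^-1 by rewrite pE -[leLHS](powRr0 (1 + gamma xi ^+ 2)) ler_powR.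
have mp := integrable_fct_meas hint.
have [mF _] := fF.
have SE : sobolev_norm2 nu gamma s F = (\int[nu]_xi ((p xi)^-1 * cnorm (F xi) ^+ 2)%:E)%E.
  by apply: eq_integral => xi _; rewrite pE.
have Fi : nu.-integrable setT (EFin \o (fun xi => (p xi)^-1 * cnorm (F xi) ^+ 2)).
  apply/integrableP; split.
    apply/measurable_EFinP; apply: measurable_funM; last exact: cmeasurable_sqr.
    (* The inverse is written as a power to use the measurability of real powers. *)
    under eq_fun do rewrite -powR_inv1 ?(ltW (p0 _))//.
    exact: (measurableT_comp (@measurable_powR R (-1)) mp).
  rewrite SE in Sfin; apply: le_lt_trans Sfin.
  rewrite le_eqVlt; apply/orP; left; apply/eqP; apply: eq_integral => xi _ /=.
  by rewrite ger0_norm// mulr_ge0 ?invr_ge0 ?sqr_ge0// ltW.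
have F1 : L1c nu (F : borel_of (dual R G) -> R[i]) by exact: (weighted_L1c (p := p)).
have F2 : L2c nu (F : borel_of (dual R G) -> R[i]).
  (* As [s] is nonnegative the Sobolev weight is at least 1, so it dominates the plain [L2]
     integrand. *)
  by apply: (L2c_le mF Fi) => xi; rewrite ler_peMl ?sqr_ge0.
exists (inv_fourier nu F); split.
- exact: (inv_fourier_continuous hG lcG rnu F1).
- have := inversion_ae hG lcG rmu rnu hpl f2 fF F2 F1.
  by apply: filterS => x ->.
- move=> x; apply: (le_trans (inv_fourier_le hG lcG x F1)).
  by rewrite SE; exact: weighted_L1_le.
Qed.
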